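(* Let $k\le\ell$, $m\in\mathbb{N}^k$ and $n\in\mathbb{N}^\ell$, and suppose $q(K_m\vee K_n)=2$. Then $\mu(m,n)=2k$ if $|m|+\iota(m)-k<\ell<2k$, and $\mu(m,n)=\ell$ otherwise. Consequently, for an integer $t$, there exists a matrix $A\in S(K_m\vee K_n)$ with exactly two distinct eigenvalues, having multiplicities $t$ and $|m|+|n|-t$, if and only if $\mu(m,n)\le t\le|m|+|n|-\mu(m,n)$.
   Context: For $m=(m_1,\dots,m_k)\in\mathbb{N}^k$: $K_m=\bigcup_{i=1}^kK_{m_i}$ (disjoint union of complete graphs), $|m|=\sum_im_i$, and $\iota(m)=|\{i:m_i=1\}|$. $G\vee H$ is the join. $S(G)$ is the set of real symmetric matrices whose off-diagonal nonzero pattern is the edge set of $G$; $q(G)$ is the minimum number of distinct eigenvalues of a matrix in $S(G)$. For $\Lambda=(\lambda_1,\dots,\lambda_r)$, $v\in\mathbb{N}_0^r$, $D_{\Lambda,v}=\bigoplus_i\lambda_iI_{v_i}$. For connected $G$ on $n$ vertices, $v\in\mathbb{N}_0^r$ is a multiplicity vector for $G$ if $\sum v_i=n$ and there are $\lambda_1<\dots<\lambda_r$ and orthogonal $U$ with $UD_{\Lambda,v}U^\top\in S(G)$. A multiplicity matrix for a graph with components $G_1,\dots,G_k$ is $V\in\mathbb{N}_0^{r\times k}$ whose $i$th column is a multiplicity vector for $G_i$. $\widetilde X$ is $X$ with first and last rows deleted; for $r\ge3$, $V\in\mathbb{N}_0^{r\times k}$, $W\in\mathbb{N}_0^{r\times\ell}$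 are compatible if $\widetilde V\mathbf 1_k=\widetilde W\mathbf 1_\ell$ and $\widetilde V^\top\widetilde W$ has all entries positive. $\mu(m,n)$ is the minimum of $\mathbf 1_{r-2}^\top\widetilde V\mathbf 1_k$ over all $r\ge 3$ and all pairs of compatible $V\in\mathbb{N}_0^{r\times k}$, $W\in\mathbb{N}_0^{r\times\ell}$ with $V$ a multiplicity matrix for $K_m$ and $W$ a multiplicity matrix for $K_n$. *)

(* Defs.v *)
From HB Require Import structures.
From mathcomp Require Import all_boot all_order all_algebra.
From mathcomp Require Import classical_sets functions cardinality reals.

Set Implicit Arguments.
Unset Strict Implicit.
Unset Printing Implicit Defensive.

Import Order.TTheory GRing.Theory Num.Theory.

Local Open Scope ring_scope.

Record sgraph := SGraph {
  vertex :> finType;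
  adj : rel vertex;
  adj_sym : symmetric adj;
  adj_irrefl : irreflexive adj
}.

Section Graphs.

Definition complete_adj n : rel 'I_n := fun x y => x != y.

Lemma complete_sym n : symmetric (@complete_adj n).
Proof. by move=> x y; rewrite /complete_adj eq_sym. Qed.

Lemma complete_irrefl n : irreflexive (@complete_adj n).
Proof. by move=> x; rewrite /complete_adj eqxx. Qed.

Definition complete n := SGraph (@complete_sym n) (@complete_irrefl n).

Definition dunion_adj (I : finType) (G : I -> sgraph) : rel {i : I & G i} :=
  fun x y => (tag x == tag y) && adj (tagged x) (tagged_as x y).

Lemma dunion_sym (I : finType) (G : I -> sgraph) : symmetric (@dunion_adj I G).
Proof.
move=> [i x] [j y]; rewrite /dunion_adj /= eq_sym.
by case: eqP => // eq_ji; case: i / eq_ji x => x; rewrite !tagged_asE adj_sym.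
Qed.

Lemma dunion_irrefl (I : finType) (G : I -> sgraph) :
  irreflexive (@dunion_adj I G).
Proof. by move=> [i x]; rewrite /dunion_adj tagged_asE adj_irrefl andbF. Qed.

Definition dunion (I : finType) (G : I -> sgraph) :=
  SGraph (@dunion_sym I G) (@dunion_irrefl I G).

Definition join_adj (G H : sgraph) : rel (G + H) := fun x y =>
  match x, y with
  | inl a, inl b => adj a b
  | inr a, inr b => adj a b
  | _, _ => true
  end.

Lemma join_sym (G H : sgraph) : symmetric (@join_adj G H).
Proof. by move=> [x|x] [y|y] //=; rewrite adj_sym. Qed.

Lemma join_irrefl (G H : sgraph) : irreflexive (@join_adj G H).
Proof. by move=> [x|x] /=; rewrite adj_irrefl. Qed.

Definition graph_join (G H : sgraph) := SGraph (@join_sym G H) (@join_irrefl G H).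

End Graphs.

Definition Kcomponents k (m : 'I_k -> nat) : 'I_k -> sgraph :=
  fun i => complete (m i).

Definition Kunion k (m : 'I_k -> nat) : sgraph := dunion (Kcomponents m).

Definition msum k (m : 'I_k -> nat) : nat := (\sum_(i < k) m i)%N.

Definition num_ones k (m : 'I_k -> nat) : nat := #|[set i | m i == 1%N]|.

(* The minimum of a set of naturals; by convention 0 for the empty set. *)
Definition set_min (A : set nat) : nat :=
  xget 0%N [set a | A a /\ forall b, A b -> (a <= b)%N]%classic.

(* Rows and columns are indexed by the vertices of G through enum_val. *)
Definition inS (R : realType) (G : sgraph) (A : 'M[R]_#|G|) : Prop :=
  A^T = A /\
  forall i j, i != j -> (A i j != 0) = adj (enum_val i) (enum_val j).

Definition eigenvalues (R : realType) n (A : 'M[R]_n) : set R :=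
  [set a | eigenvalue A a]%classic.

(* Only used for symmetric A, where geometric and algebraic multiplicities
   agree. *)
Definition multiplicity (R : realType) n (A : 'M[R]_n) (a : R) : nat :=
  \rank (eigenspace A a).

Definition qnum (R : realType) (G : sgraph) : nat :=
  set_min [set d | exists A : 'M[R]_#|G|,
                     inS A /\ (eigenvalues A #= `I_d)%card]%classic.

Definition Dmx (R : realType) r (lambda : 'I_r -> R) (v : 'I_r -> nat) :
    'M[R]_(\sum_(i < r) v i) :=
  \mxdiag_(i < r) ((lambda i)%:M : 'M[R]_(v i)).

(* Connectedness of G is not required here; the definition is only used for
   complete graphs. *)
Definition multiplicity_vector (R : realType) (G : sgraph) r
    (v : 'I_r -> nat) : Prop :=
  exists (sum_v : (\sum_(i < r) v i)%N = #|G|) (lambda : 'I_r -> R)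
         (U : 'M[R]_#|G|),
    [/\ forall i j : 'I_r, (i < j)%N -> lambda i < lambda j,
        U *m U^T = 1%:M
      & inS (U *m castmx (sum_v, sum_v) (Dmx lambda v) *m U^T)].

Definition multiplicity_matrix (R : realType) k (G : 'I_k -> sgraph) r
    (V : 'M[nat]_(r, k)) : Prop :=
  forall i : 'I_k, multiplicity_vector R (G i) (fun s => V s i).

(* r = p.+3 throughout, so that r - 2 = p.+1. *)
Definition trim p k (X : 'M[nat]_(p.+3, k)) : 'M[nat]_(p.+1, k) :=
  row' ord0 (row' ord_max X).

Definition compatible p k l (V : 'M[nat]_(p.+3, k)) (W : 'M[nat]_(p.+3, l)) :=
  trim V *m const_mx 1 = trim W *m const_mx 1 :> 'cV[nat]_p.+1 /\
  forall i j, (0 < ((trim V)^T *m trim W) i j)%N.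

Definition mu (R : realType) k l (m : 'I_k -> nat) (n : 'I_l -> nat) : nat :=
  set_min [set s | exists p (V : 'M[nat]_(p.+3, k)) (W : 'M[nat]_(p.+3, l)),
    [/\ multiplicity_matrix R (Kcomponents m) V,
        multiplicity_matrix R (Kcomponents n) W,
        compatible V W
      & s = (\sum_(i < p.+1) \sum_(j < k) trim V i j)%N]]%classic.

(* Main.v *)
(* After normalisation, a matrix of S(K_m v K_n) with two eigenvalues is given by an
   orthogonal projection P.  Let C be its off-diagonal block.  As P is idempotent,
   C C^T and C^T C are block diagonal, so rows (or columns) of C from different
   components are orthogonal: rank C >= l, and rank C >= 2k unless the rows of C in
   some component are proportional, which forces l <= |m| + iota(m) - k.  Since rank C
   is at most |m|, |n| and both eigenvalue multiplicities, this gives the lower bound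
   and the numerical constraints implied by q = 2.

   Conversely, under these constraints two interior eigenvalues suffice.  A symmetric
   involution with the prescribed block spectra is written down explicitly from a
   matching of the interior eigenvalues; conjugating it by generic orthogonal
   matrices that preserve the components makes every entry nonzero, except where a
   block vanishes or is scalar. *)

Require Import Defs.
From HB Require Import structures.
From mathcomp Require Import all_boot all_order all_algebra.
From mathcomp Require Import classical_sets functions cardinality reals.
From mathcomp Require Import spectral complex.
From mathcomp Require Import ring lra zify.

Set Implicit Arguments.
Unset Strict Implicit.
Unset Printing Implicit Defensive.

Import Order.TTheory GRing.Theory Num.Theory.

Local Open Scope ring_scope.

(** * Generic conjugation by block orthogonal matrices *)

(** The number |m| + iota(m) - k is the sum of m_i - [m_i > 1]. It is the capacity of one interior
    eigenvalue: a scalar matrix has no edges, so a complete graph on at least two vertices cannot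
    put its whole multiplicity on one eigenvalue. If a left component has a single interior
    eigenvalue of multiplicity one, all l right components must share it, so the capacity is at
    least l. Below that capacity every left component contributes at least 2, which is where 2k
    comes from. The same number v bounds mu from below by counting and bounds t from below by the
    rank of C.

    The hypothesis q = 2 supplies one matrix. The rank argument extracts from it that l <= |m| and,
    when the capacity is below l, that every m_i > 1 and 2k <= |n|. These inequalities are exactly
    what the two-level construction consumes.

    In the construction each matched pair contributes one eigenvalue 1 and one eigenvalue -1. The
    unmatched vertices carry 1 or -1 at will, so t can be anything between v and |m| + |n| - v. *)

Definition givens (R : pzRingType) n (u v : 'I_n) (c s : R) : 'M[R]_n :=
  \matrix_(i, j) if i == u then c *+ (j == u) + s *+ (j == v)
                 else if i == v then c *+ (j == v) - s *+ (j == u)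
                 else (i == j)%:R.

Lemma mul_givens (R : pzRingType) n p (u v : 'I_n) (c s : R)
    (M : 'M[R]_(n, p)) i j :
  (givens u v c s *m M) i j =
    if i == u then c * M u j + s * M v j
    else if i == v then c * M v j - s * M u j else M i j.
Proof.
have sumE (a : R) (w : 'I_n) : \sum_k a *+ (k == w) * M k j = a * M w j.
  rewrite (bigD1 w) //= eqxx mulr1n big1 ?addr0 // => k /negPf ->.
  by rewrite mulr0n mul0r.
rewrite mxE; case: (eqVneq i u) => [->|iu].
  rewrite -(sumE c u) -(sumE s v) -big_split /=; apply: eq_bigr => k _.
  by rewrite mxE eqxx mulrDl.
case: (eqVneq i v) => [iv|iv].
  rewrite -(sumE c v) -(sumE s u) -sumrB /=; apply: eq_bigr => k _.
  by rewrite mxE (negPf iu) iv eqxx mulrBl.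
rewrite -[RHS]mul1r -(sumE 1 i); apply: eq_bigr => k _.
by rewrite mxE (negPf iu) (negPf iv) eq_sym.
Qed.

Lemma givens_orthogonal (R : comPzRingType) n (u v : 'I_n) (c s : R) :
  u != v -> c ^+ 2 + s ^+ 2 = 1 -> givens u v c s *m (givens u v c s)^T = 1%:M.
Proof.
move=> uv cs1; have vu : v != u by rewrite eq_sym.
apply/matrixP => i j; rewrite mul_givens !mxE.
have [?|iu] := eqVneq i u; have [?|ju] := eqVneq j u; rewrite ?eqxx /=;
  have [?|iv] := eqVneq i v; have [?|jv] := eqVneq j v; subst; simpl in *;
  rewrite ?eqxx ?(negPf uv) ?(negPf vu) ?mulr0n ?mulr1n //=.
all: try by rewrite eqxx in uv.
all: try by rewrite -cs1; ring.
all: try ring.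
all: try by rewrite eq_sym.
all: try by rewrite ?(negPf iu) ?(negPf iv) /=; ring.
all: by rewrite eq_sym ?(negPf ju) ?(negPf jv) /=; ring.
Qed.

Lemma poly_nonroot (R : numDomainType) (p : {poly R}) :
  p != 0 -> exists x, p.[x] != 0.
Proof.
move=> p0; have [h|/forallPn [i hi]] :=
  boolP [forall i : 'I_(size p), p.[(i : nat)%:R] == 0]; last by exists i%:R.
have := @max_poly_roots _ p [seq i%:R | i <- iota 0 (size p)] p0.
rewrite size_map size_iota ltnn => H; have //: false; apply: H.
  apply/allP => _ /mapP[i + ->]; rewrite mem_iota /= add0n => lti.
  exact: (forallP h (Ordinal lti)).
by rewrite map_inj_uniq ?iota_uniq // => i j /eqP; rewrite eqr_nat => /eqP.
Qed.

(** Up to the factors [c] and [c ^+ 2], the altered off-diagonal entries are polynomials in the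
    tangent [x] of the angle: for [w] other than [u] and [v], [lin w] is the product of the two new
    entries in column [w], and [quad] is the new entry at [(u, v)]. A polynomial that vanishes
    identically is replaced by 1, so a non-root of the product of all of them serves every entry at
    once. *)
Lemma rotation_fills (R : rcfType) n (A : 'M[R]_n) (u v : 'I_n) :
  A^T = A -> u != v ->
  exists c s, let B := givens u v c s *m A *m (givens u v c s)^T in
    [/\ c ^+ 2 + s ^+ 2 = 1,
        forall i j, i != j -> A i j != 0 -> B i j != 0,
        forall w, w != u -> w != v -> A v w != 0 -> B u w != 0
      & A u u != A v v -> B u v != 0].
Proof.
move=> symA uv; have vu : v != u by rewrite eq_sym.
have AC i j : A i j = A j i by rewrite -[in LHS]symA mxE.
pose lin w : {poly R} := if (A u w == 0) && (A v w == 0) then 1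
  else ((A u w)%:P + (A v w) *: 'X) * ((A v w)%:P - (A u w) *: 'X).
pose quad : {poly R} := if (A u v == 0) && (A u u == A v v) then 1
  else (A u v)%:P + (A v v - A u u) *: 'X - A u v *: 'X^2.
have linN (a b : R) : (a == 0) && (b == 0) = false -> a%:P + b *: 'X != 0.
  apply: contraFN => /eqP p0.
  have := congr1 (fun p : {poly R} => p`_0) p0.
  have := congr1 (fun p : {poly R} => p`_1) p0.
  by rewrite /= !coefE /= !mulr1 mulr0 addr0 add0r => -> ->; rewrite eqxx.
have [x] : exists x, (quad * \prod_w lin w).[x] != 0.
  apply: poly_nonroot; apply: mulf_neq0.
    rewrite /quad; case: ifP => [_|]; first exact: oner_neq0.
    apply: contraFN => /eqP p0.
    have := congr1 (fun p : {poly R} => p`_0) p0.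
    have := congr1 (fun p : {poly R} => p`_1) p0.
    rewrite /= !coefE /= !mulr1 !mulr0 !subr0 !addr0 add0r => /eqP.
    by rewrite subr_eq0 eq_sym => -> ->; rewrite eqxx.
  apply/prodf_neq0 => w _; rewrite /lin; case: ifP => [_|h].
    exact: oner_neq0.
  by rewrite mulf_neq0 ?linN // -scaleNr linN // oppr_eq0 andbC.
rewrite hornerM horner_prod mulf_eq0 negb_or => /andP[quadx /prodf_neq0 linx].
have s0 : 0 < Num.sqrt (1 + x ^+ 2) by rewrite sqrtr_gt0 ltr_pwDl ?sqr_ge0.
pose c := (Num.sqrt (1 + x ^+ 2))^-1; have c0 : c != 0 by rewrite invr_eq0 gt_eqF.
have c2 : c ^+ 2 * (1 + x ^+ 2) = 1.
  rewrite exprVn sqr_sqrtr ?mulVf ?addr_ge0 ?sqr_ge0 //.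
  by rewrite -(@sqr_sqrtr _ (1 + x ^+ 2)) ?addr_ge0 ?sqr_ge0 // expf_neq0 ?gt_eqF.
exists c, (c * x) => /=; set B := _ *m _ *m _.
have BE i j : B i j =
   let X i := if j == u then c * A u i + c * x * A v i
     else if j == v then c * A v i - c * x * A u i else A j i in
   if i == u then c * X u + c * x * X v
   else if i == v then c * X v - c * x * X u else X i.
  have XE k : (A *m (givens u v c (c * x))^T) k j =
     if j == u then c * A u k + c * x * A v k
     else if j == v then c * A v k - c * x * A u k else A j k.
    by rewrite -mul_givens -[in LHS]symA -trmx_mul mxE.
  by rewrite /B -mulmxA mul_givens !XE.
have linP w : (A u w != 0) || (A v w != 0) ->
    c * A u w + c * x * A v w != 0 /\ c * A v w - c * x * A u w != 0.
  rewrite -negb_and => h; have := linx w isT; rewrite /lin (negPf h).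
  rewrite hornerM !hornerE mulf_eq0 negb_or => /andP[h1 h2].
  rewrite -!mulrA -mulrDr -mulrBr !mulf_eq0 (negPf c0) /=.
  by rewrite ![x * _]mulrC.
have quadP : (A u v != 0) || (A u u != A v v) -> B u v != 0.
  rewrite -negb_and => h; move: quadx; rewrite /quad (negPf h) !hornerE.
  rewrite BE /= eqxx (negPf vu) eqxx (AC v u).
  set q := _ - _; set q' := (X in _ -> X != 0).
  have -> : q' = c ^+ 2 * q by rewrite /q /q'; ring.
  by move=> ?; rewrite mulf_neq0 ?expf_neq0.
have BC i j : B i j = B j i.
  by rewrite -[in LHS](trmxK B) mxE /B !trmx_mul trmxK symA mulmxA.
split.
- by rewrite -c2; ring.
(* By symmetry of [B] it suffices to treat the order of each pair in which a rotated index comes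
   first. *)
- pose direct i j := (i == u) || ((i == v) && (j != u)) ||
    [&& i != u, i != v, j != u & j != v].
  suff H i j : i != j -> A i j != 0 -> direct i j -> B i j != 0.
    move=> i j ij Aij; case: (boolP (direct i j)) => h; first exact: H.
    rewrite BC; apply: H; [by rewrite eq_sym | by rewrite AC |].
    by move: h; rewrite /direct; case: (i == u); case: (i == v); case: (j == u); case: (j == v).
  move=> ij Aij /orP[/orP[/eqP iu|/andP[/eqP iv ju]]|/and4P[iu iv ju jv]].
  + subst i; have [jv|jv] := eqVneq j v; first by rewrite jv; apply: quadP; rewrite -jv Aij.
    have ju : j != u by rewrite eq_sym.
    rewrite BE /= eqxx (negPf ju) (negPf jv) (AC j u) (AC j v).
    by case: (linP j) => //; rewrite Aij.
  + subst i; have jv : j != v by rewrite eq_sym.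
    rewrite BE /= eqxx (negPf ju) (negPf jv) (negPf vu) (AC j u) (AC j v).
    by case: (linP j) => //; rewrite Aij orbT.
  + by rewrite BE /= (negPf iu) (negPf iv) (negPf ju) (negPf jv) AC.
- move=> w wu wv Avw; rewrite BE /= eqxx (negPf wu) (negPf wv) (AC w u) (AC w v).
  by case: (linP w) => //; rewrite Avw orbT.
- by move=> h; apply: quadP; rewrite h orbT.
Qed.

Definition block_orthogonal (R : pzRingType) n (L : eqType) (f : 'I_n -> L)
    (O : 'M[R]_n) :=
  O *m O^T = 1%:M /\ forall i j, f i != f j -> O i j = 0.

(* For [a != b] this says that the block [(a, b)] vanishes. *)
Definition block_scalar (R : pzRingType) n (L : eqType) (f : 'I_n -> L)
    (A : 'M[R]_n) (a b : L) (c : R) :=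
  forall u v, f u = a -> f v = b -> A u v = c *+ (u == v).

Lemma block_orthogonal1 (R : pzRingType) n (L : eqType) (f : 'I_n -> L) :
  block_orthogonal f (1%:M : 'M[R]_n).
Proof.
split; first by rewrite trmx1 mulmx1.
by move=> i j; rewrite mxE; have [->|//] := eqVneq i j; rewrite eqxx.
Qed.

Lemma block_orthogonalM (R : comPzRingType) n (L : eqType) (f : 'I_n -> L)
    (O Q : 'M[R]_n) :
  block_orthogonal f O -> block_orthogonal f Q -> block_orthogonal f (O *m Q).
Proof.
move=> [O1 O2] [Q1 Q2]; split.
  by rewrite trmx_mul -mulmxA (mulmxA Q) Q1 mul1mx.
move=> i j fij; rewrite mxE big1 // => k _.
have [fik|fik] := eqVneq (f i) (f k); last by rewrite O2 ?mul0r.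
by rewrite Q2 ?mulr0 // -fik.
Qed.

Lemma block_orthogonal_tr (R : comUnitRingType) n (L : eqType) (f : 'I_n -> L)
    (O : 'M[R]_n) :
  block_orthogonal f O -> block_orthogonal f O^T.
Proof.
move=> [O1 O2]; split; first by rewrite trmxK; apply: mulmx1C.
by move=> i j fij; rewrite mxE O2 // eq_sym.
Qed.

Lemma block_scalar_conj (R : comPzRingType) n (L : eqType) (f : 'I_n -> L)
    (A O : 'M[R]_n) a b c :
  block_orthogonal f O -> block_scalar f A a b c ->
  block_scalar f (O *m A *m O^T) a b c.
Proof.
move=> [O1 O2] Ac u v fu fv.
have <- : c * (O *m O^T) u v = c *+ (u == v) by rewrite O1 !mxE mulr_natr.
rewrite !mxE mulr_sumr; apply: eq_bigr => q _.
rewrite !mxE mulr_suml (bigD1 q) //= big1 ?addr0.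
  have [fuq|fuq] := eqVneq (f u) (f q); last by rewrite O2 ?mul0r ?mulr0.
  have [fvq|fvq] := eqVneq (f v) (f q); last by rewrite (O2 v) ?mulr0.
  rewrite (Ac q q); [by rewrite eqxx mulr1n; ring | by rewrite -fuq | by rewrite -fvq].
move=> p pq; have [fup|fup] := eqVneq (f u) (f p); last by rewrite O2 ?mul0r.
have [fvq|fvq] := eqVneq (f v) (f q); last by rewrite (O2 v) ?mulr0.
rewrite (Ac p q); [|by rewrite -fup|by rewrite -fvq].
by rewrite (negPf pq) mulr0n mulr0 mul0r.
Qed.

Lemma block_scalar_conj_tr (R : comUnitRingType) n (L : eqType) (f : 'I_n -> L)
    (A O : 'M[R]_n) a b c :
  block_orthogonal f O -> block_scalar f (O *m A *m O^T) a b c ->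
  block_scalar f A a b c.
Proof.
move=> orthO /(block_scalar_conj (block_orthogonal_tr orthO)).
have O1 : O^T *m O = 1%:M by apply: mulmx1C; case: orthO.
by rewrite trmxK !mulmxA O1 mul1mx -mulmxA O1 mulmx1.
Qed.

Lemma conj_sym (R : comPzRingType) n (A O : 'M[R]_n) :
  A^T = A -> (O *m A *m O^T)^T = O *m A *m O^T.
Proof. by move=> symA; rewrite !trmx_mul trmxK symA mulmxA. Qed.

Lemma block_orthogonal_givens (R : comPzRingType) n (L : eqType)
    (f : 'I_n -> L) (u v : 'I_n) (c s : R) :
  f u = f v -> u != v -> c ^+ 2 + s ^+ 2 = 1 ->
  block_orthogonal f (givens u v c s).
Proof.
move=> fuv uv cs1; split; first exact: givens_orthogonal.
move=> i j fij; rewrite mxE; have ij : i != j by apply: contraNneq fij => ->.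
have [iu|iu] := eqVneq i u.
  have [ju|ju] := eqVneq j u; first by rewrite iu ju eqxx in ij.
  have [jv|jv] := eqVneq j v; first by rewrite iu jv fuv eqxx in fij.
  by rewrite !mulr0n addr0.
have [iv|iv] := eqVneq i v; last by rewrite (negPf ij).
have [ju|ju] := eqVneq j u; first by rewrite iv ju fuv eqxx in fij.
have [jv|jv] := eqVneq j v; first by rewrite iv jv eqxx in ij.
by rewrite !mulr0n subr0.
Qed.

Definition offdiag_zeros (R : pzRingType) n (A : 'M[R]_n) : nat :=
  #|[set p : 'I_n * 'I_n | (p.1 != p.2) && (A p.1 p.2 == 0)]|.

Lemma offdiag_zeros_lt (R : pzRingType) n (A B : 'M[R]_n) u v :
  (forall i j, i != j -> A i j != 0 -> B i j != 0) ->
  u != v -> A u v = 0 -> B u v != 0 ->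
  (offdiag_zeros B < offdiag_zeros A)%N.
Proof.
move=> AB uv Auv Buv; apply/proper_card/properP; split.
  apply/fintype.subsetP => -[i j]; rewrite !inE /= => /andP[ij Bij].
  by rewrite ij; apply: contraLR Bij; apply: AB.
by exists (u, v); rewrite !inE /= uv ?Auv ?eqxx.
Qed.

(* Rotating by a generic angle in a coordinate plane inside a class never
   destroys an off-diagonal nonzero entry, and creates one unless each block of
   [A] is already free of unwanted zeros. *)
Lemma generic_conj (R : rcfType) n (L : eqType) (f : 'I_n -> L) (A : 'M[R]_n) :
  A^T = A ->
  exists2 O, block_orthogonal f O &
    forall u v, u != v -> (O *m A *m O^T) u v = 0 ->
      exists c, block_scalar f A (f u) (f v) c.
Proof.
have [N] := ubnP (offdiag_zeros A); elim: N A => // N IH A leN symA.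
have AC i j : A i j = A j i by rewrite -[in LHS]symA mxE.
(* The induction is on the number of off-diagonal zeros. A rotation inside a class that fills one of
   them lowers it, and the conclusion transfers back because being scalar on a block is invariant
   under block orthogonal conjugation. *)
have step u v i j : f u = f v -> u != v -> i != j -> A i j = 0 ->
    (forall c s, let B := givens u v c s *m A *m (givens u v c s)^T in
      [/\ c ^+ 2 + s ^+ 2 = 1,
        forall i j, i != j -> A i j != 0 -> B i j != 0,
        forall w, w != u -> w != v -> A v w != 0 -> B u w != 0
      & A u u != A v v -> B u v != 0] -> B i j != 0) ->
  exists2 O, block_orthogonal f O &
    forall u v, u != v -> (O *m A *m O^T) u v = 0 ->
      exists c, block_scalar f A (f u) (f v) c.
  move=> fuv uv ij Aij0 H; have [c [s /= P]] := rotation_fills symA uv.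
  have Bij := H _ _ P; case: P; set B := _ *m _ *m _ => cs1 AB _ _.
  have orthG := block_orthogonal_givens fuv uv cs1.
  have [||O orthO OP] := IH B; [|exact: conj_sym|].
    by apply: leq_trans (offdiag_zeros_lt AB ij Aij0 Bij) _; rewrite -ltnS.
  exists (O *m givens u v c s); first exact: block_orthogonalM.
  move=> x y xy xy0; have [|e Be] := OP x y xy.
    by rewrite -xy0 trmx_mul !mulmxA.
  by exists e; apply: block_scalar_conj_tr Be.
have [/existsP[u /existsP[v /existsP[w /and5P[/eqP fuv uv wu wv /andP[/eqP Auw Avw]]]]]|Npat] :=
  boolP [exists u, exists v, exists w,
    [&& f u == f v, u != v, w != u, w != v & (A u w == 0) && (A v w != 0)]].
  by apply: (step u v u w) => // [|c s B [_ _ h _]]; [rewrite eq_sym | apply: h].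
have [/existsP[u /existsP[v /and4P[/eqP fuv uv /eqP Auv Auuvv]]]|Ndiag] :=
  boolP [exists u, exists v,
    [&& f u == f v, u != v, A u v == 0 & A u u != A v v]].
  by apply: (step u v u v) => // c s B [_ _ _ h]; apply: h.
(* No rotation helps any longer. A zero then spreads over the off-diagonal entries of its block
   ([pat]), and inside a diagonal block it forces equal diagonal entries ([diag]). *)
exists 1%:M; first exact: block_orthogonal1.
rewrite mul1mx trmx1 mulmx1 => u v uv Auv.
have pat x y z : f x = f z -> z != y -> A x y = 0 -> x != y -> A z y = 0.
  move=> fxz zy Axy xy; have [<-//|xz] := eqVneq x z.
  apply/eqP; apply: contraNT Npat => Azy; apply/existsP; exists x.
  apply/existsP; exists z; apply/existsP; exists y.
  by rewrite fxz eqxx xz Axy eqxx Azy eq_sym xy eq_sym zy.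
have diag x y : f x = f y -> x != y -> A x y = 0 -> A x x = A y y.
  move=> fxy xy Axy; apply/eqP; apply: contraNT Ndiag => h.
  by apply/existsP; exists x; apply/existsP; exists y; rewrite fxy xy Axy !eqxx.
have [fuv|fuv] := eqVneq (f u) (f v); last first.
  exists 0 => x y fx fy; rewrite mul0rn.
  have fne a b : f a = f u -> f b = f v -> a != b.
    by move=> fa fb; apply: contraNneq fuv => ab; rewrite -fa -fb ab.
  have Axv : A x v = 0 by apply: (pat u) => //; apply: fne.
  rewrite AC; apply: (pat v) => //; rewrite 1?AC //; rewrite eq_sym; exact: fne.
have off x y : f x = f u -> f y = f u -> x != y -> A x y = 0.
  move=> fx fy xy; have [xv|xv] := eqVneq x v.
    have [yu|yu] := eqVneq y u; first by rewrite xv yu AC.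
    have yv : y != v by rewrite -xv eq_sym.
    by rewrite xv AC; apply: (pat u).
  have Axv : A x v = 0 by apply: (pat u).
  have [->//|yv] := eqVneq y v; rewrite AC; apply: (pat v); rewrite -?fuv 1?AC //.
    by rewrite eq_sym.
  by rewrite eq_sym.
exists (A u u) => x y fx; rewrite -fuv => fy.
have [<-|xy] := eqVneq x y; last by rewrite (off x y) // mulr0n.
rewrite mulr1n; have [->//|xu] := eqVneq x u.
by apply: diag => //; apply: off.
Qed.

(** * Realization of a pair of compatible matrices *)

Lemma subset_select (T L : finType) (c : T -> L) (D : {set T}) (q : L -> nat) :
  (forall a, q a <= #|[set u in D | c u == a]|)%N ->
  exists2 S : {set T}, S \subset D &
    forall a, #|[set u in S | c u == a]| = q a.
Proof.
move=> leq_q; pose K a := [set u in D | c u == a].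
exists [set u | u \in take (q (c u)) (enum (K (c u)))].
  apply/fintype.subsetP => u; rewrite inE => /mem_take.
  by rewrite mem_enum inE => /andP[].
move=> a; rewrite -[RHS](@size_takel _ _ (enum (K a))) -?cardE ?leq_q //.
rewrite -(card_uniqP (take_uniq _ (enum_uniq _))); apply: eq_card => u.
rewrite !inE; have [->|ua] := eqVneq (c u) a; first by rewrite andbT.
rewrite andbF; apply/esym/negP => /mem_take.
by rewrite mem_enum inE (negPf ua) andbF.
Qed.

(** Within a label, the vertex of index i in the enumeration of one side is exchanged with the
    vertex of index i on the other side. *)
Lemma label_matching (T : finType) (L : eqType) (D : {set T}) (side : T -> bool)
    (f : T -> L) :
  (forall a, #|[set u in D | side u & f u == a]| =
             #|[set u in D | ~~ side u & f u == a]|) ->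
  exists2 s : T -> T, involutive s &
    (forall x, x \notin D -> s x = x) /\
    (forall x, x \in D -> [/\ s x \in D, side (s x) = ~~ side x & f (s x) = f x]).
Proof.
move=> eq_card_sides; pose K b a := enum [set u in D | side u == b & f u == a].
have eq_size b a : size (K b a) = size (K (~~ b) a).
  suff E : size (K true a) = size (K false a) by case: b.
  rewrite /K -!cardE; have := eq_card_sides a.
  rewrite (_ : [set u in D | side u & f u == a] = [set u in D | side u == true & f u == a]).
    move=> ->; apply: eq_card => u; rewrite !inE; by case: (side u).
  by apply/setP => u; rewrite !inE; case: (side u).
pose s x := if x \in D then
  nth x (K (~~ side x) (f x)) (index x (K (side x) (f x))) else x.
have memK x : x \in D -> x \in K (side x) (f x).
  by move=> Dx; rewrite mem_enum inE Dx !eqxx.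
have sK x : x \in D -> s x \in K (~~ side x) (f x).
  by move=> Dx; rewrite /s Dx mem_nth // -eq_size index_mem memK.
have sP x : x \in D -> [/\ s x \in D, side (s x) = ~~ side x & f (s x) = f x].
  by move/sK; rewrite mem_enum inE => /and3P[-> /eqP -> /eqP ->].
exists s; last by split=> // x xD; rewrite /s (negPf xD).
move=> x; case Dx: (x \in D); last by rewrite /s Dx Dx.
have [Dsx side_sx f_sx] := sP x Dx.
rewrite {1}/s Dsx side_sx f_sx negbK {2}/s Dx.
rewrite index_uniq ?enum_uniq -?eq_size ?index_mem ?memK //.
by rewrite (set_nth_default x) ?index_mem ?memK // nth_index ?memK.
Qed.

(** When [e (s u) = - e u], the two-point orbit of [u] carries the reflection with rows (e, g) and
    (g, -e). Where [g] vanishes, [e] is an eigenvalue by itself. *)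
Definition involution_mx (R : pzRingType) n (s : 'I_n -> 'I_n) (e g : 'I_n -> R) :
    'M[R]_n :=
  \matrix_(u, v) (e u *+ (u == v) + g u *+ (v == s u)).

Lemma involution_mx_sym (R : pzRingType) n (s : 'I_n -> 'I_n) (e g : 'I_n -> R) :
  involutive s -> (forall u, g (s u) = g u) ->
  (involution_mx s e g)^T = involution_mx s e g.
Proof.
move=> sK gs; apply/matrixP => u v; rewrite !mxE eq_sym.
have [->//|_] := eqVneq u v; congr (_ + _).
rewrite -(can2_eq sK sK) eq_sym.
by have [<-|//] := eqVneq (s u) v; rewrite gs.
Qed.

Lemma involution_mx_sqr (R : comPzRingType) n (s : 'I_n -> 'I_n)
    (e g : 'I_n -> R) :
  involutive s -> (forall u, g (s u) = g u) ->
  (forall u, e u ^+ 2 + g u ^+ 2 = 1) ->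
  (forall u, g u * (e u + e (s u)) = 0) ->
  involution_mx s e g *m involution_mx s e g = 1%:M.
Proof.
move=> sK gs eg geV; set A := involution_mx s e g.
apply/matrixP => u v.
have sumE (a : R) (w : 'I_n) : \sum_k a *+ (k == w) * A k v = a * A w v.
  rewrite (bigD1 w) //= eqxx mulr1n big1 ?addr0 // => k /negPf ->.
  by rewrite mulr0n mul0r.
transitivity (e u * A u v + g u * A (s u) v).
  rewrite -!sumE -big_split mxE; apply: eq_bigr => w _.
  by rewrite [A u w]mxE mulrDl (eq_sym u).
rewrite /A !mxE sK gs (eq_sym v u) (eq_sym (s u)) -(eg u).
(* A vanishing term is added so that all four outcomes of the two equality tests become ring
   identities. *)
have -> : (e u ^+ 2 + g u ^+ 2) *+ (u == v) = (e u ^+ 2 + g u ^+ 2) *+ (u == v)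
   + (g u * (e u + e (s u))) *+ (v == s u) by rewrite geV mul0rn addr0.
case: (u == v); case: (v == s u); rewrite ?mulr0n ?mulr1n; ring.
Qed.

Lemma sum_antisymmetric (R : numDomainType) (T : finType) (s : T -> T)
    (h : T -> R) :
  involutive s -> (forall x, h (s x) = - h x) -> \sum_x h x = 0.
Proof.
move=> sK hs; have : \sum_x h x = - \sum_x h x.
  rewrite [LHS](reindex_inj (inv_inj sK)) -sumrN.
  by apply: eq_bigr => x _; rewrite hs.
by move/eqP; rewrite -addr_eq0 -mulr2n mulrn_eq0 => /eqP.
Qed.

Definition join_pattern (R : pzRingType) N k l (c : 'I_N -> 'I_k + 'I_l)
    (A : 'M[R]_N) :=
  forall u v, u != v ->
    (A u v != 0) = (c u == c v) || (is_inl (c u) != is_inl (c v)).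

(* [s] pairs left with right vertices, [e] is the diagonal.  A generic conjugation
   inside the eigenspaces of the left diagonal block first spreads each matched
   pair over all pairs of vertices at the same level; a generic conjugation inside
   the components then removes the remaining unwanted zeros. *)
Lemma realize_matching (R : rcfType) N k l (c : 'I_N -> 'I_k + 'I_l)
    (s : 'I_N -> 'I_N) (e g : 'I_N -> R) :
  involutive s -> (forall u, g (s u) = g u) ->
  (forall u, e u ^+ 2 + g u ^+ 2 = 1) ->
  (forall u, g u != 0 ->
     is_inl (c (s u)) = ~~ is_inl (c u) /\ e (s u) = - e u) ->
  (forall u v, u != v -> c u = c v ->
     exists x y, [/\ c x = c u, c y = c u & e x != e y]) ->
  (forall i j, exists u v,
     [/\ c u = inl i, c v = inr j, g v != 0 & e u = - e v]) ->
  exists A : 'M[R]_N,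
    [/\ A^T = A, A *m A = 1%:M, \tr A = \sum_u e u & join_pattern c A].
Proof.
move=> sK gs eg gP nonscalar shared; pose A0 := involution_mx s e g.
have symA0 : A0^T = A0 by apply: involution_mx_sym.
have A0sqr : A0 *m A0 = 1%:M.
  apply: involution_mx_sqr => // u; have [->|/gP[_ ->]] := eqVneq (g u) 0.
    by rewrite mul0r.
  by rewrite subrr mulr0.
have A0E u v : is_inl (c u) = is_inl (c v) -> A0 u v = e u *+ (u == v).
  move=> cuv; rewrite mxE; have [->|/gP[h _]] := eqVneq (g u) 0.
    by rewrite mul0rn addr0.
  have [vs|_] := eqVneq v (s u); last by rewrite mulr0n addr0.
  by move: h; rewrite -vs -cuv; case: is_inl.
(* Left vertices are grouped by their diagonal value and right vertices are singletons, so this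
   conjugation leaves both diagonal blocks unchanged and mixes only the rows that share an
   eigenvalue. *)
pose f1 u : R + 'I_N := if is_inl (c u) then inl (e u) else inr u.
have [O1 orthO1 O1P] := generic_conj f1 symA0.
pose A1 := O1 *m A0 *m O1^T.
have symA1 : A1^T = A1 by apply: conj_sym.
have A1E u v : is_inl (c u) = is_inl (c v) -> A1 u v = e u *+ (u == v).
  move=> cuv; apply: (@block_scalar_conj _ _ _ f1 A0 O1 (f1 u) (f1 v)) => //.
  move=> x y; rewrite /f1 -cuv.
  case cu: (is_inl (c u)); case cx: (is_inl (c x)) => //;
    case cy: (is_inl (c y)) => // -[ex] -[ey].
    by rewrite A0E ?cx ?cy // ex.
  by rewrite A0E ?cx ?cy // ex.
(* The partner [s v] has diagonal value [- e v = e u], hence lies in the class of [u]. A zero at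
   [(u, v)] would kill the entry at [(s v, v)] of [A0], which is [g v]. *)
have A1ne u v : is_inl (c u) -> ~~ is_inl (c v) -> g v != 0 -> e u = - e v ->
    A1 u v != 0.
  move=> cu cv gv euv; have [csv esv] := gP v gv.
  apply/eqP => Auv0; have uv : u != v by apply: contraNneq cv => <-.
  have [d /(_ (s v) v)] := O1P u v uv Auv0.
  have svv : s v != v by apply/eqP => E; move: csv; rewrite E; case: is_inl.
  rewrite /f1 csv cu (negPf cv) /= esv euv => /(_ erefl erefl).
  rewrite mxE (negPf svv) sK eqxx gs mulr0n mulr1n add0r => g0.
  by rewrite g0 eqxx in gv.
have [O2 orthO2 O2P] := generic_conj c symA1.
pose A2 := O2 *m A1 *m O2^T.
have trO (O A : 'M[R]_N) : block_orthogonal f1 O \/ block_orthogonal c O ->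
    \tr (O *m A *m O^T) = \tr A /\
    (A *m A = 1%:M -> (O *m A *m O^T) *m (O *m A *m O^T) = 1%:M).
  move=> orthO; have OO : O *m O^T = 1%:M by case: orthO => -[].
  have OO' := mulmx1C OO; split; first by rewrite mxtrace_mulC mulmxA OO' mul1mx.
  move=> AA; rewrite -(mulmxA _ O^T) (mulmxA O^T) (mulmxA O^T) OO' mul1mx.
  by rewrite (mulmxA (O *m A)) -(mulmxA O) AA mulmx1.
have [tr1 sqr1] := trO O1 A0 (or_introl orthO1).
have [tr2 sqr2] := trO O2 A1 (or_intror orthO2).
exists A2; split.
- exact: conj_sym.
- exact/sqr2/sqr1.
- rewrite tr2 tr1; apply: eq_bigr => u _.
  by rewrite A0E // eqxx mulr1n.
(* Inside a component [A1] is diagonal with two distinct values, so its block is not scalar and the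
   generic conjugate has no zero off the diagonal there. *)
move=> u v uv; have [cuv|cuv] := eqVneq (c u) (c v) => /=.
  apply/eqP => /(O2P _ _ uv)[d]; rewrite -cuv => scal.
  have [x [y [cx cy /eqP exy]]] := nonscalar u v uv cuv; apply: exy.
  have := scal x x cx cx; have := scal y y cy cy.
  by rewrite !A1E // !eqxx !mulr1n => -> ->.
have [suv|suv] := eqVneq (is_inl (c u)) (is_inl (c v)) => /=.
  suff -> : A2 u v = 0 *+ (u == v) by rewrite mul0rn eqxx.
  apply: (@block_scalar_conj _ _ _ c A1 O2 (c u) (c v)) => // x y cx cy.
  rewrite A1E ?cx ?cy // mul0rn; have [xy|_] := eqVneq x y; last by rewrite mulr0n.
  by rewrite -cx -cy xy eqxx in cuv.
have A1sym x y : A1 x y = A1 y x by rewrite -[in LHS]symA1 mxE.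
apply/eqP => /(O2P _ _ uv)[d scal].
have A10 x y : c x = c u -> c y = c v -> A1 x y = 0.
  move=> cx cy; rewrite scal //; have [xy|_] := eqVneq x y; last by rewrite mulr0n.
  by rewrite -cx -cy xy eqxx in cuv.
case cu: (c u) suv => [i|j]; case cv: (c v) => [i'|j'] //= _.
  have [x [y [cx cy gy exy]]] := shared i j'.
  have := A1ne x y; rewrite cx cy /= => /(_ isT isT gy exy).
  by rewrite A10 ?eqxx // ?cx ?cy.
have [x [y [cx cy gy exy]]] := shared i' j.
have := A1ne x y; rewrite cx cy /= => /(_ isT isT gy exy).
by rewrite A1sym A10 ?eqxx // ?cx ?cy.
Qed.

(* [q1] and [q2] are the two interior rows of a pair of compatible matrices with
   four rows, the columns of [V] and [W] being indexed together by
   ['I_k + 'I_l]; [sz] gives the orders of the components. *)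
Definition two_level k l (sz q1 q2 : 'I_k + 'I_l -> nat) :=
  [/\ forall a, (0 < q1 a + q2 a <= sz a)%N,
      forall a, (1 < sz a)%N -> (q1 a != sz a) && (q2 a != sz a),
      (\sum_i q1 (inl i) = \sum_j q1 (inr j))%N,
      (\sum_i q2 (inl i) = \sum_j q2 (inr j))%N
    & forall i j, (0 < q1 (inl i) * q1 (inr j) + q2 (inl i) * q2 (inr j))%N].

Lemma card_label_classes (T L : finType) (c : T -> L) (S : {set T}) (P : pred L) :
  #|[set u in S | P (c u)]| =
    (\sum_(a | P a) #|[set u in S | c u == a]|)%N.
Proof.
rewrite -sum1_card (partition_big c P) => [|u]; last by rewrite inE => /andP[].
apply: eq_bigr => a Pa; rewrite -sum1_card; apply: eq_bigl => u.
by rewrite !inE; case: eqP => [->|]; rewrite ?Pa ?andbF ?andbT.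
Qed.

Lemma sum_inl (k l : nat) (F : 'I_k + 'I_l -> nat) :
  (\sum_(a | is_inl a) F a = \sum_i F (inl i))%N.
Proof.
by rewrite big_sumType /= [X in (_ + X)%N]big_pred0_eq addn0.
Qed.

Lemma sum_inr (k l : nat) (F : 'I_k + 'I_l -> nat) :
  (\sum_(a | ~~ is_inl a) F a = \sum_j F (inr j))%N.
Proof. by rewrite big_sumType /= [X in (X + _)%N]big_pred0_eq add0n. Qed.

(** The multiplicity is carried by the trace. With s matched pairs, which have trace zero, the N -
    2s free vertices receive t - s entries 1 and N - s - t entries -1, giving 2t - N. *)
Lemma realize_two_level (R : rcfType) N k l (c : 'I_N -> 'I_k + 'I_l)
    (q1 q2 : 'I_k + 'I_l -> nat) (t : nat) :
  two_level (fun a => #|[set u | c u == a]|) q1 q2 ->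
  (\sum_i (q1 (inl i) + q2 (inl i)) <= t)%N ->
  (t + \sum_i (q1 (inl i) + q2 (inl i)) <= N)%N ->
  exists A : 'M[R]_N,
    [/\ A^T = A, A *m A = 1%:M, \tr A = t%:R *+ 2 - N%:R & join_pattern c A].
Proof.
move=> [qle qne q1sum q2sum shared] s_le_t ts_le_N.
set s := (\sum_i _)%N in s_le_t ts_le_N.
have [|S1 _ S1q] := @subset_select _ _ c [set: 'I_N] q1.
  move=> a; have /andP[_] := qle a; rewrite (_ : [set _ in _ | _] = [set u | c u == a]).
    by move=> h; apply: leq_trans h; apply: leq_addr.
  by apply/setP => u; rewrite !inE.
have [|S2 S2S1 S2q] := @subset_select _ _ c (~: S1) q2.
  move=> a; have /andP[_] := qle a.
  rewrite -(cardsID S1 [set u | c u == a]).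
  rewrite (_ : _ :&: S1 = [set u in S1 | c u == a]); last first.
    by apply/setP => u; rewrite !inE andbC.
  rewrite S1q leq_add2l => h; apply: leq_trans h _; apply: subset_leq_card.
  apply/fintype.subsetP => u; rewrite !inE; by case: (u \in S1) => //=; rewrite andbF.
have S2notS1 u : u \in S2 -> u \notin S1.
  by move/(fintype.subsetP S2S1); rewrite inE.
pose side u := is_inl (c u); pose D := S1 :|: S2.
have cardS (S : {set 'I_N}) q (P : pred ('I_k + 'I_l)) :
    (forall a, #|[set u in S | c u == a]| = q a) ->
    #|[set u in S | P (c u)]| = (\sum_(a | P a) q a)%N.
  by move=> Sq; rewrite card_label_classes; apply: eq_bigr => a _.
(* Inside [D], membership in [S2] tells the two levels apart and serves as the label to be
   matched. *)
have [|sg sgK [sgN sgD]] := @label_matching _ _ D side (mem S2).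
  have sideE (b a : bool) : #|[set u in D | (side u == b) & ((u \in S2) == a)]| =
      (\sum_(x : 'I_k + 'I_l | is_inl x == b) (if a then q2 x else q1 x))%N.
    rewrite -(cardS (if a then S2 else S1)); last by case: a.
    apply: eq_card => u; rewrite !inE /side.
    case: a; case u2: (u \in S2); case u1: (u \in S1) => //=; rewrite ?andbT ?andbF //.
    by move: (S2notS1 u u2); rewrite u1.
  move=> a; have H1 := sideE true a; have H2 := sideE false a.
  rewrite (_ : [set u in D | _ & _] = [set u in D | side u == true & (u \in S2) == a]);
    last by apply/setP => u; rewrite !inE; case: (side u).
  rewrite H1 (_ : [set u in D | _ & _] = [set u in D | side u == false & (u \in S2) == a]);
    last by apply/setP => u; rewrite !inE; case: (side u).
  rewrite H2 (eq_bigl is_inl); last by case.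
  rewrite [RHS](eq_bigl (fun x => ~~ is_inl x)); last by case.
  by rewrite sum_inl sum_inr; case: (a).
have cardD : #|D| = (s + s)%N.
  have cardT q (S : {set 'I_N}) : (forall a, #|[set u in S | c u == a]| = q a) ->
      #|S| = (\sum_i q (inl i) + \sum_j q (inr j))%N.
    move=> Sq; have := cardS _ _ xpredT Sq; rewrite big_sumType /= => <-.
    by apply: eq_card => u; rewrite !inE andbT.
  rewrite cardsU (_ : S1 :&: S2 = finset.set0) ?cards0 ?subn0; last first.
    apply/setP => u; rewrite !inE; case u1: (u \in S1) => //=.
    by apply/negP => /S2notS1; rewrite u1.
  rewrite (cardT _ _ S1q) (cardT _ _ S2q) -q1sum -q2sum /s big_split /=; lia.
have cardDC : #|~: D| = (N - (s + s))%N.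
  by rewrite -cardD cardsCs finset.setCK card_ord.
have [|S3 S3D S3q] := @subset_select _ _ (fun=> tt) (~: D) (fun=> t - s)%N.
  move=> []; rewrite (_ : [set _ in _ | _] = ~: D).
    by rewrite cardDC leq_subRL; lia.
  by apply/setP => u; rewrite !inE andbT.
have cardS3 : #|S3| = (t - s)%N.
  by rewrite -(S3q tt); apply: eq_card => u; rewrite !inE andbT.
(* The interior eigenvalues are 0 and 3/5 on the left, with opposite values on the right. The triple
   3, 4, 5 keeps [g] rational. *)
pose e u : R := if u \in S1 then 0 else if u \in S2 then
  (if side u then 3 / 5 else - (3 / 5)) else if u \in S3 then 1 else -1.
pose g u : R := if u \in S1 then 1 else if u \in S2 then 4 / 5 else 0.
have S12 u : u \in D -> (u \in S1) = (u \notin S2).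
  rewrite inE; case u2: (u \in S2); last by rewrite orbF.
  by rewrite (negPf (S2notS1 u u2)).
have gD u : (g u != 0) = (u \in D).
  rewrite /g inE; case: ifP => _; first by rewrite oner_eq0.
  by case: ifP => _; rewrite ?eqxx // lt0r_neq0 ?divr_gt0 ?ltr0n.
have gsg u : g (sg u) = g u.
  case uD: (u \in D); last by rewrite sgN ?uD.
  have [suD _ f_su] := sgD u uD; rewrite /g !S12 //.
  by move: f_su => /= ->.
have esg u : g u != 0 -> is_inl (c (sg u)) = ~~ is_inl (c u) /\ e (sg u) = - e u.
  rewrite gD => uD; have [suD side_su f_su] := sgD u uD; split=> //.
  rewrite /e !S12 // side_su; move: f_su => /= ->.
  by case: (u \in S2) => /=; rewrite ?oppr0 //; case: (side u); rewrite ?opprK.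
have [|u v uv cuv|i j|A [symA sqrA trA patA]] :=
  @realize_matching R N k l c sg e g sgK gsg _ esg.
- move=> u; rewrite /e /g; case: ifP => _; first by rewrite expr0n add0r expr1n.
  case: ifP => _; first by case: ifP => _; lra.
  by case: ifP => _; rewrite expr0n addr0 ?sqrrN expr1n.
(* A component with two vertices has a vertex [x] in [D], and neither level fills it, so some vertex
   has a diagonal value other than [e x]. *)
- have sz_gt1 : (1 < #|[set x | c x == c u]|)%N.
    rewrite (cardD1 u) (cardD1 v) !inE eqxx -cuv eqxx eq_sym uv; lia.
  have /andP[ne1 ne2] := qne _ sz_gt1; have /andP[gt0 _] := qle (c u).
  have [x cx xD] : exists2 x, c x = c u & x \in D.
    have [/existsP[x /andP[/eqP cx xD]]|] := boolP [exists x, (c x == c u) && (x \in D)].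
      by exists x.
    move=> /existsPn h; move: gt0; rewrite -S1q -S2q.
    rewrite !(eq_card0 (_ : [set _ in _ | _] =i pred0)) // => x; rewrite !inE.
      by have := h x; rewrite inE; case: (x \in S2); case: (c x == c u); rewrite ?orbT ?andbF.
    by have := h x; rewrite inE; case: (x \in S1); case: (c x == c u); rewrite ?orbT ?andbF.
  have [/existsP[y /andP[/eqP cy exy]]|] := boolP [exists y, (c y == c u) && (e x != e y)].
    by exists x, y.
  move=> /existsPn h; exfalso.
  have eE y : c y = c u -> e y = e x.
    by move=> cy; have := h y; rewrite cy eqxx /= negbK => /eqP.
  have sideE y : c y = c u -> side y = side x by move=> cy; rewrite /side cy cx.
  have [x1|x1] := boolP (x \in S1).
    move/eqP: ne1; apply; rewrite -S1q; apply: eq_card => y; rewrite !inE.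
    have [cy|] := eqVneq (c y) (c u); last by rewrite andbF.
    rewrite andbT; have := eE y cy; rewrite /e x1; case: ifP => // _.
    by case: ifP => _; case: ifP => _; clear => ?; lra.
  have x2 : x \in S2 by move: xD; rewrite inE (negPf x1).
  move/eqP: ne2; apply; rewrite -S2q; apply: eq_card => y; rewrite !inE.
  have [cy|] := eqVneq (c y) (c u); last by rewrite andbF.
  rewrite andbT; have := eE y cy; rewrite /e (negPf x1) x2 sideE //.
  case: ifP => _; first by case: ifP => _; clear => ?; lra.
  by case: ifP => // _; case: ifP => _; case: ifP => _; clear => ?; lra.
- have ex (S : {set 'I_N}) q a : (forall a, #|[set u in S | c u == a]| = q a) -> (0 < q a)%N ->
      exists2 u, u \in S & c u = a.
    by move=> Sq; rewrite -Sq => /card_gt0P[u]; rewrite inE => /andP[uS /eqP]; exists u.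
  have := shared i j; rewrite addn_gt0 !muln_gt0 => /orP[/andP[hi hj]|/andP[hi hj]].
    have [u uS cu] := ex _ _ _ S1q hi; have [v vS cv] := ex _ _ _ S1q hj.
    exists u, v; split; rewrite ?gD ?inE ?vS //.
    by rewrite /e uS vS oppr0.
  have [u uS cu] := ex _ _ _ S2q hi; have [v vS cv] := ex _ _ _ S2q hj.
  exists u, v; split; rewrite ?gD ?inE ?vS ?orbT //.
  by rewrite /e (negPf (S2notS1 _ uS)) (negPf (S2notS1 _ vS)) uS vS /side cu cv /= opprK.
exists A; split=> //; rewrite trA.
pose h u := if u \in D then e u else 0.
have -> : \sum_u e u = \sum_u h u + \sum_(u in ~: D) e u.
  rewrite [LHS](bigID (mem D)) /=; congr (_ + _); first by rewrite big_mkcond.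
  by apply: eq_bigl => u; rewrite !inE.
rewrite (@sum_antisymmetric _ _ sg h sgK) ?add0r; last first.
  move=> u; rewrite /h; case uD: (u \in D); last by rewrite sgN ?uD ?oppr0.
  by have [-> _ _] := sgD u uD; case: (esg u); rewrite ?gD.
rewrite (bigID (mem S3)) /=.
have e3 u : u \notin D -> e u = if u \in S3 then 1 else -1.
  by rewrite inE negb_or /e => /andP[/negPf -> /negPf ->].
rewrite (eq_bigr (fun=> 1)); last first.
  by move=> u /andP[]; rewrite inE => /e3 -> ->.
rewrite [X in _ + X](eq_bigr (fun=> -1)); last first.
  by move=> u /andP[]; rewrite inE => /e3 -> /negPf ->.
rewrite !sumr_const.
have -> : #|[pred u | (u \in ~: D) && (u \in S3)]| = (t - s)%N.
  rewrite -cardS3; apply: eq_card => u; rewrite !inE andbC.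
  by case u3: (u \in S3) => //=; have := fintype.subsetP S3D u u3; rewrite !inE.
have -> : #|[pred u | (u \in ~: D) && (u \notin S3)]| = (N - (s + s) - (t - s))%N.
  rewrite -cardS3 -cardDC -cardsDS //; apply: eq_card => u; rewrite !inE andbC.
  by case: (u \in S3).
have hN : (N - (s + s) - (t - s) = N - s - t)%N by lia.
rewrite mulNrn hN !natrB; try lia.
by rewrite mulr2n; ring.
Qed.

(** * Feasible multiplicities *)

Lemma sum_interpolation n (lo hi : 'I_n -> nat) (T : nat) :
  (forall i, lo i <= hi i)%N -> (\sum_i lo i <= T <= \sum_i hi i)%N ->
  exists2 f : 'I_n -> nat, (forall i, lo i <= f i <= hi i)%N &
    (\sum_i f i)%N = T.
Proof.
move=> lohi /andP[]; elim: T => [|T IH].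
  rewrite leqn0 => /eqP lo0 _; exists lo => // i; by rewrite leqnn lohi.
rewrite leq_eqVlt => /orP[/eqP <- _|].
  by exists lo => // i; rewrite leqnn lohi.
rewrite ltnS => loT hiT; have [f fP fT] := IH loT (ltnW hiT).
have [/existsP[i fi]|/existsPn h] := boolP [exists i, (f i < hi i)%N]; last first.
  move: hiT; rewrite ltnNge -fT => /negP[]; apply: leq_sum => i _.
  by rewrite leqNgt.
exists (fun j => f j + (j == i))%N => [j|].
  have /andP[h1 h2] := fP j; rewrite (leq_trans h1) ?leq_addr //=.
  by have [->|_] := eqVneq j i; rewrite ?addn1 ?addn0.
rewrite big_split /= fT (bigD1 i) //= eqxx big1 ?addn0 ?addn1 // => j /negPf ->.
by [].
Qed.

Lemma sum_le_const n (F : 'I_n -> nat) c :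
  (forall i, c <= F i)%N -> (n * c <= \sum_i F i)%N.
Proof.
move=> h; rewrite -[n in (n * _)%N]card_ord -sum_nat_const; exact: leq_sum.
Qed.

Lemma sum_eq_const n c : (\sum_(i < n) c = n * c)%N.
Proof. by rewrite sum_nat_const card_ord. Qed.

(** If one level has capacity l, it is enough to use that level alone. Otherwise every left
    component meets both levels, so it shares one with each right component. The total is then the
    larger of 2k (two per left component) and l (one per right component). *)
Lemma two_level_exists k l (sz : 'I_k + 'I_l -> nat) :
  (0 < k)%N -> (k <= l)%N -> (forall a, 0 < sz a)%N ->
  (l <= \sum_i sz (inl i))%N ->
  (\sum_i (sz (inl i) - (1 < sz (inl i))) < l ->
    (forall i, 1 < sz (inl i)) /\ 2 * k <= \sum_j sz (inr j))%N ->
  exists q1 q2, two_level sz q1 q2 /\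
    (\sum_i (q1 (inl i) + q2 (inl i)) =
      if \sum_i (sz (inl i) - (1 < sz (inl i))) < l < 2 * k then 2 * k else l)%N.
Proof.
move=> k_gt0 le_kl sz_gt0 l_le special.
have [S_lt|S_ge] := ltnP _ l; last first.
  have [||c cP csum] := @sum_interpolation k (fun=> 1%N)
    (fun i => sz (inl i) - (1 < sz (inl i)))%N l.
  - by move=> i; have := sz_gt0 (inl i); case: ltnP => /=; lia.
  - by rewrite S_ge sum_eq_const muln1 le_kl.
  exists (fun a => if a is inl i then c i else 1%N), (fun=> 0%N).
  split; last by rewrite /= -csum; apply: eq_bigr => i _; rewrite addn0.
  split=> /=.
  - case=> [i|j]; rewrite addn0 ?sz_gt0 //; have /andP[-> h] := cP i.
    by apply: leq_trans h _; apply: leq_subr.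
  - case=> [i|j] h; last by rewrite !ltn_eqF // sz_gt0.
    by have := cP i; rewrite h /=; lia.
  - by rewrite csum sum_eq_const muln1.
  - by rewrite !sum_eq_const !muln0.
  - by move=> i j; rewrite muln1 muln0 addn0; case/andP: (cP i).
have [m_gt1 n_ge] := special S_lt; case: ltnP => /= [l_lt|l_ge].
  (* With one left copy per component and level, each level must hold k right copies; [d j] is the
     total allotted to right component j. *)
  have [||d dP dsum] := @sum_interpolation l (fun=> 1%N) (fun j => sz (inr j)) (2 * k).
  - by move=> j; apply: sz_gt0.
  - by rewrite n_ge sum_eq_const muln1 ltnW.
  have d_half : (\sum_j (1 < d j) <= k)%N.
    rewrite -(leq_pmul2l (isT : 0 < 2)%N) -dsum big_distrr /=.
    by apply: leq_sum => j _; have := dP j; case: ltnP => /=; lia.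
  have d_split : (\sum_j (1 < d j) + \sum_j (d j - (1 < d j)) = 2 * k)%N.
    rewrite -dsum -big_split /=; apply: eq_bigr => j _.
    by have := dP j; case: ltnP => /=; lia.
  (* These bounds make a right component with [d j > 1] use both levels, so that it is never
     concentrated on one. *)
  have [||a aP asum] := @sum_interpolation l (fun j => (1 < d j) : nat)
    (fun j => d j - (1 < d j))%N k.
  - by move=> j; have := dP j; case: ltnP => /=; lia.
  - by apply/andP; split => //; lia.
  have adP j : (a j <= d j)%N by have := aP j; lia.
  exists (fun x => if x is inr j then a j else 1%N),
    (fun x => if x is inr j then d j - a j else 1%N)%N.
  split; last by rewrite sum_eq_const mulnC.
  split=> /=.
  - case=> [i|j]; first by rewrite /= m_gt1.
    by have := dP j; have := adP j; lia.
  - case=> [i|j] h; first by rewrite !ltn_eqF.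
    by have := dP j; have := aP j; case: ltnP => /=; lia.
  - by rewrite asum sum_eq_const muln1.
  - rewrite sum_eq_const muln1 -(@addnK (\sum_j a j)%N (\sum_j _)%N) -big_split /=.
    rewrite (eq_bigr d) => [|j _]; last by rewrite subnK.
    by rewrite dsum asum; lia.
  - by move=> i j; rewrite !mul1n subnKC //; case/andP: (dP j).
(* Now l >= 2k: each right component takes one copy, k of them at the first level and l - k at the
   second, while left component i takes 1 and [c i - 1]. *)
have [||c cP csum] := @sum_interpolation k (fun=> 2%N) (fun i => sz (inl i)) l.
- by move=> i; apply: m_gt1.
- by rewrite l_le sum_eq_const mulnC l_ge.
have [||a aP asum] := @sum_interpolation l (fun=> 0%N) (fun=> 1%N) k.
- by [].
- by rewrite !sum_eq_const muln1 muln0 le_kl.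
exists (fun x => if x is inr j then a j else 1%N),
  (fun x => match x with inl i => c i - 1 | inr j => 1 - a j end)%N.
split; last first.
  by rewrite /= -csum; apply: eq_bigr => i _; have := cP i; lia.
split=> /=.
- case=> [i|j]; first by have := cP i; lia.
  by have := aP j; have := sz_gt0 (inr j); lia.
- case=> [i|j] h.
    have := cP i; rewrite ltn_eqF //=; lia.
  have := aP j => /= aj; lia.
- by rewrite asum sum_eq_const muln1.
- have E1 : (\sum_i (c i - 1) + \sum_(i < k) 1 = l)%N.
    rewrite -big_split /= -csum; apply: eq_bigr => i _; by have := cP i; lia.
  have E2 : (\sum_j (1 - a j) + \sum_(j < l) a j = \sum_(j < l) 1)%N.
    rewrite -big_split /=; apply: eq_bigr => j _; by have := aP j; lia.
  by move: E1 E2; rewrite asum !sum_eq_const !muln1 => E1 E2; apply: (@addIn k); rewrite E1 E2.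
- move=> i j; rewrite mul1n; have := cP i; have := aP j.
  by case: (a j) => [|[|?]]; rewrite ?subn0 ?subnn ?muln0 ?muln1; lia.
Qed.

(** * Rank of the off-diagonal block *)

Lemma rank_row_support (F : fieldType) m n (A : 'M[F]_(m, n)) (S : {set 'I_m}) :
  (forall u, u \notin S -> row u A = 0) -> (\rank A <= #|S|)%N.
Proof.
move=> A0; apply: (@leq_trans (\rank (\sum_(u in S) <<row u A>>)%MS)).
  apply/mxrankS/row_subP => u; have [uS|/A0 ->] := boolP (u \in S).
    by rewrite (sumsmx_sup u) // genmxE.
  exact: sub0mx.
apply: leq_trans (mxrank_sum_leqif _) _ => /=; rewrite -sum1_card.
by apply: leq_sum => u _; rewrite mxrank_gen rank_leq_row.
Qed.

Lemma dotmx_eq0 (R : realDomainType) n (v : 'rV[R]_n) :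
  (v *m v^T == 0) = (v == 0).
Proof.
apply/eqP/eqP => [v0|->]; last by rewrite mul0mx.
have := congr1 (fun M : 'M_1 => M 0 0) v0; rewrite !mxE.
under eq_bigr do rewrite mxE -expr2.
move/eqP; rewrite psumr_eq0 => [/allP h|i _]; last exact: sqr_ge0.
apply/rowP => i; have := h i; rewrite mem_index_enum sqrf_eq0 mxE => /(_ isT).
by move/eqP.
Qed.

Lemma orthogonal_family_rank (R : realFieldType) (J : finType) n p
    (v : J -> 'rV[R]_n) (C : 'M[R]_(p, n)) :
  (forall j, v j <= C)%MS -> (forall j, v j != 0) ->
  (forall i j, i != j -> v i *m (v j)^T = 0) -> (#|J| <= \rank C)%N.
Proof.
move=> vC v0 v_orth; pose K := \matrix_(i < #|J|) v (enum_val i).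
apply: (@leq_trans (\rank K)); last first.
  by apply/mxrankS/row_subP => i; rewrite rowK.
suff /eqP-> : row_free K by [].
apply/row_freeP; pose d j := (v j *m (v j)^T) 0 0.
exists (\matrix_(a, b) (K b a / d (enum_val b))).
apply/matrixP => a b; rewrite mxE.
transitivity ((v (enum_val a) *m (v (enum_val b))^T) 0 0 / d (enum_val b)).
  by rewrite mxE mulr_suml; apply: eq_bigr => u _; rewrite !mxE mulrA.
rewrite [RHS]mxE; have [->|ab] := eqVneq a b; last first.
  by rewrite v_orth ?(inj_eq enum_val_inj) // mxE mul0r.
rewrite divff //; apply: contra (v0 (enum_val b)) => /eqP d0.
by rewrite -dotmx_eq0; apply/eqP/matrixP => x y; rewrite !ord1 [RHS]mxE.
Qed.


Lemma join_pattern_zero (R : pzRingType) N k l (c : 'I_N -> 'I_k + 'I_l)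
    (P : 'M[R]_N) u v :
  join_pattern c P -> is_inl (c u) = is_inl (c v) -> c u != c v -> P u v = 0.
Proof.
move=> patP Guv cuv; have uv : u != v by apply: contraNneq cuv => ->.
by apply/eqP; move: (patP u v uv); rewrite (negPf cuv) Guv eqxx => /negbFE.
Qed.

Lemma join_pattern_nonzero (R : pzRingType) N k l (c : 'I_N -> 'I_k + 'I_l)
    (P : 'M[R]_N) u v :
  join_pattern c P -> is_inl (c u) != is_inl (c v) -> P u v != 0.
Proof.
move=> patP Guv; have uv : u != v by apply: contraNneq Guv => ->.
by rewrite patP // Guv orbT.
Qed.

(* If the rows of the off-diagonal block indexed by one left component are all
   proportional to [y], then [y] is an eigenvector of the right diagonal block,
   hence so is its restriction to each of the [l] right components.  These
   yield [l] orthogonal eigenvectors of the left diagonal block for a single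
   eigenvalue, and in a left component with at least two vertices such an
   eigenvector vanishes as soon as it vanishes off one vertex. *)
Lemma proportional_rows_bound (R : realFieldType) N k l
    (c : 'I_N -> 'I_k + 'I_l) (P : 'M[R]_N) (u0 : 'I_N) (x : 'I_N -> R) :
  let sz (a : 'I_k + 'I_l) := #|[set u | c u == a]| in
  (forall a, 0 < sz a)%N -> P^T = P -> P *m P = P -> join_pattern c P ->
  is_inl (c u0) ->
  (forall u h, c u = c u0 -> ~~ is_inl (c h) -> P u h = x u * P u0 h) ->
  (l <= \sum_i (sz (inl i) - (1 < sz (inl i))))%N.
Proof.
move=> sz sz_gt0 symP PP patP Gu0 propP; pose G u := is_inl (c u).
have PC i j : P i j = P j i by rewrite -[in LHS]symP mxE.
have PG u v : G u = G v -> c u != c v -> P u v = 0 by apply: join_pattern_zero.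
have PGH u v : G u != G v -> P u v != 0 by apply: join_pattern_nonzero.
have PPE u v : P u v = \sum_w P u w * P w v by rewrite -[in LHS]PP mxE.
have rep a : exists u, c u = a.
  by have := sz_gt0 a => /card_gt0P[u]; rewrite inE => /eqP; exists u.
pose y j : 'rV_N := \row_h (if c h == inr j then P u0 h else 0).
have yG j g : G g -> y j 0 g = 0.
  by rewrite mxE /G; case: eqP => // ->.
(* In the entry of [P = P *m P] at [(u0, h)], with [h] on the right, proportionality turns the left
   part of the sum into a multiple of [P u0 h]. What remains gives the eigenvalue [nu], the same for
   all right components. *)
pose nu := 1 - \sum_(g | G g) P u0 g * x g.
have yP_own j h : c h = inr j -> (y j *m P) 0 h = nu * P u0 h.
  move=> ch; have Gh : ~~ G h by rewrite /G ch.
  rewrite mulrBl mul1r [X in X - _]PPE (bigID G) /= mulr_suml.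
  rewrite addrC [X in _ + X - _](eq_bigr (fun g => P u0 g * x g * P u0 h)); last first.
    move=> g Gg; have [cg|cg] := eqVneq (c u0) (c g).
      by rewrite (propP g h) ?mulrA.
    by rewrite PG ?mul0r // /G Gu0.
  rewrite addrK mxE [RHS]big_mkcond; apply: eq_bigr => w _; rewrite mxE.
  have [cw|cw] := eqVneq (c w) (inr j); first by rewrite /G cw.
  case: ifP => Gw; last by rewrite mul0r.
  by rewrite (PG w h) ?mul0r ?mulr0 ?ch // (negPf Gw) (negPf Gh).
clearbody nu.
have yP j h : ~~ G h -> (y j *m P) 0 h = nu * y j 0 h.
  move=> Gh; have [ch|ch] := eqVneq (c h) (inr j).
    by rewrite yP_own // mxE ch eqxx.
  rewrite mxE big1 ?mxE ?(negPf ch) ?mulr0 // => w _; rewrite mxE.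
  have [cw|_] := eqVneq (c w) (inr j); last by rewrite mul0r.
  by rewrite (PG w h) ?mulr0 // ?cw 1?eq_sym // (negPf Gh) /G cw.
(* Subtracting [nu *: y j] leaves the left part of [y j *m P]. By idempotence it is an eigenvector
   of the left diagonal block for [1 - nu]. *)
pose z j := y j *m P - nu *: y j.
have zE j w : z j 0 w = (y j *m P) 0 w - nu * y j 0 w.
  by rewrite [LHS]mxE; congr (_ + _); rewrite !mxE.
have zH j h : ~~ G h -> z j 0 h = 0 by move=> Gh; rewrite zE yP // subrr.
have zG j g : G g -> z j 0 g = (y j *m P) 0 g.
  by move=> Gg; rewrite zE yG // mulr0 subr0.
have zP j : z j *m P = (1 - nu) *: (y j *m P).
  by rewrite mulmxBl -mulmxA PP -scalemxAl scalerBl scale1r.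
have zPG j g : G g -> (z j *m P) 0 g = (1 - nu) * z j 0 g.
  by move=> Gg; rewrite zP zG // [LHS]mxE.
have z0 j : z j != 0.
  apply/eqP => /rowP/(_ u0); rewrite zG // [RHS]mxE mxE.
  rewrite (eq_bigr (fun h => if c h == inr j then P u0 h ^+ 2 else 0)); last first.
    by move=> h _; rewrite mxE; case: ifP; rewrite ?mul0r // (PC h) expr2.
  move/eqP; rewrite psumr_eq0 => [|h _]; last by case: ifP; rewrite ?sqr_ge0.
  have [h ch] := rep (inr j); move=> /allP/(_ h).
  rewrite mem_index_enum ch eqxx sqrf_eq0 => /(_ isT).
  by apply/negP; apply: PGH; rewrite /G Gu0 ch.
have z_orth i j : i != j -> z i *m (z j)^T = 0.
  move=> ij; have zy : z i *m (y j)^T = 0.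
    apply/matrixP => a b; rewrite !ord1 mxE [RHS]mxE big1 // => w _.
    have [Gw|Gw] := boolP (G w); last by rewrite zH ?mul0r.
    by rewrite [X in _ * X]mxE yG ?mulr0.
  have yPy : y i *m P *m (y j)^T = 0.
    apply/matrixP => a b; rewrite !ord1 mxE [RHS]mxE big1 // => w _.
    rewrite [X in _ * X]mxE; have [Gw|Gw] := boolP (G w).
      by rewrite yG ?mulr0.
    rewrite yP // !mxE; have [->|] := eqVneq (c w) (inr i); last by rewrite mulr0 mul0r.
    by rewrite (inj_eq (@inr_inj _ _)) (negPf ij) mulr0.
  rewrite [(z j)^T]linearB /= trmx_mul symP mulmxBr mulmxA zP -scalemxAl yPy.
  by rewrite scaler0 linearZ /= -scalemxAr zy scaler0 subrr.
pose Z := \matrix_(j < l) z j.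
have Zfree : row_free Z.
  rewrite /row_free eqn_leq rank_leq_row /= -[l in (l <= _)%N]card_ord.
  apply: (@orthogonal_family_rank _ _ _ _ z) => // j.
  by rewrite -[z j](rowK z) row_sub.
have [g gP] := fin_all_exists (fun i => rep (inl i)).
(* [S] omits one vertex [g i] from every left component of order at least two. The vectors [z j]
   stay independent after restriction to [S]. *)
pose S := [set u | if c u is inl i then ~~ ((1 < sz (inl i))%N && (u == g i)) else false].
have S_le : (#|S| <= \sum_i (sz (inl i) - (1 < sz (inl i))))%N.
  have -> : #|S| = #|[set u in S | is_inl (c u)]|.
    by apply: eq_card => u; rewrite !inE; case: (c u) => ? /=; rewrite ?andbT ?andbF.
  rewrite (card_label_classes c _ (fun a => is_inl a)) sum_inl.
  apply: leq_sum => i _; case: ltnP => /= sz1; last first.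
    rewrite subn0; apply: subset_leq_card; apply/fintype.subsetP => u.
    by rewrite !inE => /andP[].
  rewrite [sz (inl i)](cardsD1 (g i)) !inE gP eqxx add1n subn1 /=.
  apply: subset_leq_card; apply/fintype.subsetP => u; rewrite !inE.
  by move=> /andP[+ /eqP cu]; rewrite cu sz1 eqxx andbT.
apply: leq_trans S_le.
pose Z' := \matrix_(j, u) (if u \in S then Z j u else 0).
have rankZ' : (\rank Z' <= #|S|)%N.
  rewrite -mxrank_tr; apply: rank_row_support => u uS.
  by apply/rowP => j; rewrite !mxE (negPf uS).
suff /eqP <- : row_free Z' by [].
apply: inj_row_free => w wZ'; pose t := w *m Z.
have tS u : u \in S -> t 0 u = 0.
  move=> uS; transitivity ((w *m Z') 0 u); last by rewrite wZ' mxE.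
  by rewrite !mxE; apply: eq_bigr => j _; rewrite [Z' _ _]mxE uS.
have tH h : ~~ G h -> t 0 h = 0.
  move=> Gh; rewrite mxE big1 // => j _.
  have -> : Z j h = z j 0 h by rewrite [LHS]mxE.
  by rewrite zH ?mulr0.
have tP u : G u -> (t *m P) 0 u = (1 - nu) * t 0 u.
  move=> Gu; rewrite -mulmxA mxE [in RHS]mxE mulr_sumr; apply: eq_bigr => j _.
  have -> : (Z *m P) j u = (z j *m P) 0 u.
    by rewrite -[z j](rowK z) -row_mul [RHS]mxE.
  rewrite zPG // mulrCA; congr (_ * (_ * _)); by rewrite [RHS]mxE.
suff t0 : t = 0.
  by apply: (row_free_inj Zfree); rewrite mul0mx.
apply/rowP => u; rewrite [RHS]mxE.
have [Gu|] := boolP (G u); last exact: tH.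
have [|uS] := boolP (u \in S); first exact: tS.
move: (Gu) uS; rewrite inE /G; case cu: (c u) => [i|//] _; rewrite negbK.
move=> /andP[/card_gt1P[a [b [ca cb ab]]] /eqP ug].
have [v cv vu] : exists2 v, c v = inl i & v != u.
  move: ca cb; rewrite !inE => /eqP ca /eqP cb.
  by have [au|au] := eqVneq a u; [exists b; rewrite // -au eq_sym | exists a].
have Gv : G v by rewrite /G cv.
have vS : v \in S by rewrite inE cv -ug (negPf vu) andbF.
(* At a neighbour [v] of the omitted vertex [u], where [t] vanishes, the eigenvector equation
   reduces to [t 0 u * P u v = 0]. *)
have := tP v Gv; rewrite tS // mulr0 mxE (bigD1 u) //= big1 ?addr0.
  move/eqP; rewrite mulf_eq0 (negPf (_ : P u v != 0)) ?orbF => [/eqP//|].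
  by rewrite patP 1?eq_sym // cu cv eqxx.
move=> w' w'u; have [Gw|Gw] := boolP (G w'); last by rewrite tH ?mul0r.
have [w'S|w'S] := boolP (w' \in S); first by rewrite tS ?mul0r.
rewrite (PG w' v) ?mulr0 ?Gv //.
move: w'S; rewrite inE cv; case: (c w') => [i'|j'] //; rewrite negbK => /andP[_ /eqP w'g].
apply: contraNneq w'u => -[i'i]; by rewrite w'g i'i ug.
Qed.

(* [P] and [1 - P] are the spectral projections of a matrix with two distinct
   eigenvalues.  Since [P] is idempotent and block diagonal on each side of the
   join, so are the Gram matrices [C C^T] and [C^T C] of its off-diagonal block
   [C]: rows of [C] in different components are orthogonal. *)
Lemma join_projection_rank (R : realFieldType) N k l (c : 'I_N -> 'I_k + 'I_l)
    (P : 'M[R]_N) :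
  let sz (a : 'I_k + 'I_l) := #|[set u | c u == a]| in
  (0 < k)%N -> (0 < l)%N -> (forall a, 0 < sz a)%N ->
  P^T = P -> P *m P = P -> join_pattern c P ->
  exists r, [/\ (l <= r)%N,
    (r <= minn (\rank P) (\rank (1%:M - P)%R))%N,
    (r <= minn (\sum_i sz (inl i)) (\sum_j sz (inr j)))%N &
    (\sum_i (sz (inl i) - (1 < sz (inl i))) < l)%N ->
      (forall i, 1 < sz (inl i))%N /\ (2 * k <= r)%N].
Proof.
move=> sz k_gt0 l_gt0 sz_gt0 symP PP patP.
pose G u := is_inl (c u).
have PC i j : P i j = P j i by rewrite -[in LHS]symP mxE.
have PG u v : G u = G v -> c u != c v -> P u v = 0 by apply: join_pattern_zero.
have PGH u v : G u != G v -> P u v != 0 by apply: join_pattern_nonzero.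
have PPE u v : P u v = \sum_w P u w * P w v by rewrite -[in LHS]PP mxE.
have rep a : exists u, c u = a.
  by have := sz_gt0 a => /card_gt0P[u]; rewrite inE => /eqP; exists u.
(* In the sum for [(P *m P) u v], an index on the side of [u] and [v] would have to lie in both of
   their components, so only the opposite side contributes. *)
have gram0 u v : G u = G v -> c u != c v ->
    \sum_(w | G w != G u) P u w * P v w = 0.
  move=> Guv cuv; rewrite -[RHS](PG u v Guv cuv) PPE [RHS](bigID (fun w => G w != G u)) /=.
  rewrite [X in _ = _ + X]big1 ?addr0; last first.
    move=> w; rewrite negbK => /eqP Gw; have [cw|cw] := eqVneq (c u) (c w).
      by rewrite (PG w v) ?mulr0 ?Gw // -cw.
    by rewrite PG ?mul0r.
  by apply: eq_bigr => w _; rewrite (PC v).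
pose C := \matrix_(u, v) (if G u && ~~ G v then P u v else 0).
have rowC u : ~~ G u -> row u C = 0.
  by move=> Gu; apply/rowP => v; rewrite !mxE (negPf Gu).
have rowCT u : G u -> row u C^T = 0.
  by move=> Gu; apply/rowP => v; rewrite !mxE Gu andbF.
have rankG : (\rank C <= \sum_i sz (inl i))%N.
  apply: leq_trans (rank_row_support (S := [set u in [set: 'I_N] | G u]) _) _.
    by move=> u; rewrite !inE => /rowC.
  rewrite (card_label_classes c _ (fun a => is_inl a)) sum_inl; apply: leq_sum => i _.
  by apply: subset_leq_card; apply/fintype.subsetP => u; rewrite !inE.
have rankH : (\rank C <= \sum_j sz (inr j))%N.
  rewrite -mxrank_tr.
  apply: leq_trans (rank_row_support (S := [set u in [set: 'I_N] | ~~ G u]) _) _.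
    by move=> u; rewrite !inE negbK => /rowCT.
  rewrite (card_label_classes c _ (fun a => ~~ is_inl a)) sum_inr; apply: leq_sum => i _.
  by apply: subset_leq_card; apply/fintype.subsetP => u; rewrite !inE.
pose E b : 'M[R]_N := diag_mx (\row_u (G u == b)%:R).
have EM (A : 'M[R]_N) u v : (E true *m A *m E false) u v =
    if G u && ~~ G v then A u v else 0.
  rewrite mul_mx_diag mul_diag_mx !mxE.
  by case: (G u); case: (G v); rewrite /= ?mulr0 ?mulr1 ?mul1r ?mul0r.
have CE : C = E true *m P *m E false by apply/matrixP => u v; rewrite EM mxE.
(* The identity has no off-diagonal block, so [C] is also cut out of [1%:M - P] up to sign. This
   bounds its rank by that of both projections. *)
have CE' : C = - (E true *m (1%:M - P) *m E false).
  apply/matrixP => u v; rewrite [RHS]mxE EM !mxE; case: ifP => [/andP[Gu Gv]|_].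
    have [uv|_] := eqVneq u v; first by rewrite -uv Gu in Gv.
    by rewrite sub0r opprK.
  by rewrite oppr0.
exists (\rank C); split.
- have hr j : exists u, c u = inr j by exact: rep.
  have [h hP] := fin_all_exists hr.
  have [g cg] := rep (inl (Ordinal k_gt0)).
  rewrite -mxrank_tr -[l in (l <= _)%N]card_ord.
  apply: (@orthogonal_family_rank _ _ _ _ (fun j => row (h j) C^T)).
  + by move=> j; apply: row_sub.
  + move=> j; apply/eqP => /rowP/(_ g); rewrite !mxE /G cg hP /= => /eqP.
    by apply/negP; apply: PGH; rewrite /G cg hP.
  + move=> i j ij; apply/matrixP => x y; rewrite !mxE.
    rewrite -[RHS](gram0 (h i) (h j)) ?hP ?/G ?hP //.
    rewrite [RHS]big_mkcond; apply: eq_bigr => w _.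
    rewrite !mxE /G !hP; case: (is_inl (c w)); rewrite /= ?mul0r //.
    by rewrite (PC w (h i)) (PC w (h j)).
- rewrite leq_min; apply/andP; split.
    by rewrite CE; apply: leq_trans (mxrankM_maxl _ _) (mxrankM_maxr _ _).
  by rewrite CE' mxrank_opp; apply: leq_trans (mxrankM_maxl _ _) (mxrankM_maxr _ _).
- by rewrite leq_min rankG rankH.
move=> S_lt.
have rows_orth u v : G u -> G v -> c u != c v -> row u C *m (row v C)^T = 0.
  move=> Gu Gv cuv; apply/matrixP => a b; rewrite !mxE.
  rewrite -[RHS](gram0 u v) ?Gu // [RHS]big_mkcond; apply: eq_bigr => w _.
  by rewrite !mxE Gu Gv; case: (G w); rewrite ?mul0r.
pose dot (u v : 'I_N) : R := (row u C *m (row v C)^T) 0 0.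
(* The Gram-Schmidt residual of row [v] against row [u]. If all residuals vanish in a component, its
   rows are proportional and the capacity reaches l. *)
pose res u v := row v C - (dot v u / dot u u) *: row u C.
have dot_gt0 u : G u -> dot u u != 0.
  move=> Gu; have [h ch] := rep (inr (Ordinal l_gt0)).
  have Gh : ~~ G h by rewrite /G ch.
  have : row u C != 0.
    apply/eqP => /rowP/(_ h); rewrite !mxE Gu Gh => /eqP.
    by apply/negP; apply: PGH; rewrite Gu (negPf Gh).
  apply: contra => /eqP d0; rewrite -dotmx_eq0.
  by apply/eqP/matrixP => a b; rewrite !ord1 [RHS]mxE.
have res_orth u v : G u -> res u v *m (row u C)^T = 0.
  move=> Gu; apply/matrixP => a b; rewrite !ord1 mulmxBl -scalemxAl.
  rewrite [LHS]mxE [X in _ + X]mxE [X in _ - X]mxE -/(dot v u) -/(dot u u).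
  by rewrite divfK ?dot_gt0 // subrr mxE.
have indep i : exists uv, [/\ c uv.1 = inl i, c uv.2 = inl i & res uv.1 uv.2 != 0].
  have [/existsP[uv /and3P[/eqP ? /eqP ? ?]]|/existsPn h] := boolP
    [exists uv, [&& c uv.1 == inl i, c uv.2 == inl i & res uv.1 uv.2 != 0]].
    by exists uv.
  have [u0 cu0] := rep (inl i).
  have Gu0 : G u0 by rewrite /G cu0.
  move: S_lt; rewrite ltnNge.
  rewrite (@proportional_rows_bound _ _ _ _ c P u0
    (fun u => dot u u0 / dot u0 u0)) // => u h' cu Gh'.
  have Gu : G u by rewrite /G cu.
  have /eqP/rowP/(_ h') : res u0 u == 0.
    by have := h (u0, u); rewrite /= cu cu0 eqxx /= negbK.
  by rewrite !mxE -/(G u) -/(G u0) Gu Gu0 Gh' => /subr0_eq.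
have [uv uvP] := fin_all_exists indep.
have uvG i : G (uv i).1 /\ G (uv i).2.
  by have [c1 c2 _] := uvP i; rewrite /G c1 c2.
split=> [i|].
  have [c1 c2 res0] := uvP i; apply/card_gt1P; exists (uv i).1, (uv i).2.
  rewrite !inE c1 c2 eqxx; split=> //; apply: contraNneq res0 => <-.
  by rewrite /res divff ?scale1r ?subrr // dot_gt0; case: (uvG i).
pose f (x : 'I_k * bool) := if x.2 then res (uv x.1).1 (uv x.1).2
  else row (uv x.1).1 C.
rewrite (_ : 2 * k = #|{: 'I_k * bool}|)%N; last first.
  by rewrite card_prod card_ord card_bool mulnC.
apply: (@orthogonal_family_rank _ _ _ _ f).
- move=> [i []]; rewrite /f /= ?row_sub //.
  by rewrite addmx_sub ?row_sub // -scaleNr scalemx_sub // row_sub.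
- move=> [i []]; rewrite /f /=; first by case: (uvP i).
  have := dot_gt0 (uv i).1 (proj1 (uvG i)); apply: contra => /eqP r0.
  by rewrite /dot r0 mul0mx mxE.
have diff i j a b : i != j -> f (i, a) *m (f (j, b))^T = 0.
  move=> ij; have [Gi1 Gi2] := uvG i; have [Gj1 Gj2] := uvG j.
  have [ci1 ci2 _] := uvP i; have [cj1 cj2 _] := uvP j.
  have ro u v : G u -> G v -> c u = inl i -> c v = inl j ->
      row u C *m (row v C)^T = 0.
    move=> Gu Gv cu cv; apply: rows_orth => //.
    by rewrite cu cv (inj_eq (@inl_inj _ _)).
  have fl v : G v -> c v = inl j -> f (i, a) *m (row v C)^T = 0.
    move=> Gv cv; rewrite /f /=; case: a; last exact: ro.
    by rewrite mulmxBl -scalemxAl !ro // scaler0 subrr.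
  rewrite {2}/f /=; case: b; last exact: fl.
  rewrite (_ : (res _ _)^T = (row (uv j).2 C)^T -
    (dot (uv j).2 (uv j).1 / dot (uv j).1 (uv j).1) *: (row (uv j).1 C)^T).
    by rewrite mulmxBr -scalemxAr !fl // scaler0 subrr.
  by apply/matrixP => x y; rewrite !mxE.
move=> [i a] [j b]; have [->|ij _] := eqVneq i j; last exact: diff.
have [Gj1 Gj2] := uvG j; case: a; case: b; rewrite ?eqxx // => _.
  exact: res_orth.
by rewrite -[LHS]trmxK trmx_mul trmxK res_orth ?trmx0.
Qed.

(** * Vertices of the join *)

Definition join_label k l (m : 'I_k -> nat) (n : 'I_l -> nat)
    (x : graph_join (Kunion m) (Kunion n)) : 'I_k + 'I_l :=
  match x with inl z => inl (tag z) | inr z => inr (tag z) end.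

Lemma Kunion_adjE k (m : 'I_k -> nat) (x y : Kunion m) :
  x != y -> adj x y = (tag x == tag y).
Proof.
case: x y => [i x] [j y]; rewrite /adj /= /dunion_adj /=.
have [ij|] := eqVneq i j => //=; case: j / ij y => y; rewrite tagged_asE.
by rewrite -tag_eqE /tag_eq /= eqxx tagged_asE.
Qed.

Lemma join_adjE k l (m : 'I_k -> nat) (n : 'I_l -> nat)
    (x y : graph_join (Kunion m) (Kunion n)) :
  x != y -> adj x y = (join_label x == join_label y) ||
                      (is_inl (join_label x) != is_inl (join_label y)).
Proof.
case: x y => [x|x] [y|y] //= xy; rewrite orbF.
  rewrite (inj_eq (@inl_inj _ _)); apply: (@Kunion_adjE _ m).
  by apply: contra xy => /eqP ->.
rewrite (inj_eq (@inr_inj _ _)); apply: (@Kunion_adjE _ n).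
by apply: contra xy => /eqP ->.
Qed.

Definition vertex_label k l (m : 'I_k -> nat) (n : 'I_l -> nat)
    (u : 'I_#|graph_join (Kunion m) (Kunion n)|) : 'I_k + 'I_l :=
  join_label (enum_val u).

Definition class_size k l (m : 'I_k -> nat) (n : 'I_l -> nat) (a : 'I_k + 'I_l) :=
  match a with inl i => m i | inr j => n j end.

Lemma card_Kunion_component k (m : 'I_k -> nat) i :
  #|[set z : Kunion m | tag z == i]| = m i.
Proof.
have tagI : injective (fun x : 'I_(m i) => Tagged (fun i => 'I_(m i)) x).
  by move=> x y /eqP; rewrite -tag_eqE /tag_eq /= eqxx tagged_asE => /eqP.
rewrite -[RHS]card_ord -(card_imset _ tagI).
apply: eq_card => -[j x]; rewrite inE /=; apply/eqP/imsetP => [ji|[y _ /eqP]].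
  by subst i; exists x.
by rewrite -tag_eqE /tag_eq /= => /andP[/eqP].
Qed.

Lemma card_vertex_label k l (m : 'I_k -> nat) (n : 'I_l -> nat) a :
  #|[set u | vertex_label (m := m) (n := n) u == a]| = class_size m n a.
Proof.
rewrite -(card_imset _ enum_val_inj).
transitivity #|[set x | join_label (m := m) (n := n) x == a]|.
  apply: eq_card => x; rewrite inE; apply/imsetP/idP => [[u + ->]|xa].
    by rewrite inE.
  by exists (enum_rank x); rewrite ?inE /vertex_label enum_rankK.
case: a => [i|j] /=; rewrite -card_Kunion_component.
  rewrite -(card_imset [set z : Kunion m | tag z == i] (@inl_inj _ (Kunion n))).
  apply: eq_card => x; rewrite inE; apply/idP/imsetP => [|[z]].
    by case: x => [z|z] // zi; exists z; rewrite ?inE.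
  by rewrite inE => zi ->.
rewrite -(card_imset [set z : Kunion n | tag z == j] (@inr_inj (Kunion m) _)).
apply: eq_card => x; rewrite inE; apply/idP/imsetP => [|[z]].
  by case: x => [z|z] // zj; exists z; rewrite ?inE.
by rewrite inE => zj ->.
Qed.

Lemma card_join k l (m : 'I_k -> nat) (n : 'I_l -> nat) :
  #|graph_join (Kunion m) (Kunion n)| = (msum m + msum n)%N.
Proof.
pose c := vertex_label (m := m) (n := n).
transitivity #|[set u in [set: 'I_#|graph_join (Kunion m) (Kunion n)|] | predT (c u)]|.
  by rewrite -[LHS]card_ord; apply: eq_card => u; rewrite !inE.
rewrite card_label_classes big_sumType /=; congr (_ + _)%N.
  apply: eq_bigr => i _; rewrite -[RHS]/(class_size m n (inl i)) -card_vertex_label.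
  by apply: eq_card => u; rewrite !inE.
apply: eq_bigr => j _; rewrite -[RHS]/(class_size m n (inr j)) -card_vertex_label.
by apply: eq_card => u; rewrite !inE.
Qed.

Lemma inS_join (R : realType) k l (m : 'I_k -> nat) (n : 'I_l -> nat)
    (A : 'M[R]_#|graph_join (Kunion m) (Kunion n)|) :
  inS A <-> A^T = A /\ join_pattern (vertex_label (m := m) (n := n)) A.
Proof.
by split=> -[symA patA]; split=> // u v uv; rewrite patA // join_adjE //;
  rewrite (inj_eq enum_val_inj).
Qed.

(** * Matrices with two eigenvalues *)

Lemma card_eq2 (T : eqType) (A : set T) :
  (A #= `I_2)%card -> exists x y, x != y /\ A = [set x; y]%classic.
Proof.
move=> /card_set_bijP[f [fun_f inj_f surj_f]].
have [x Ax fx] := surj_f 0%N isT; have [y Ay fy] := surj_f 1%N isT.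
exists x, y; split; first by apply/eqP => xy; rewrite -xy fx in fy.
apply/seteqP; split=> [z Az|z [->|->]] //.
by have := fun_f z Az => /=; case Ez: (f z) => [|[|//]] _;
  [left|right]; apply: inj_f; rewrite ?inE ?Ez.
Qed.

(** Over [R[i]] the matrix is unitarily diagonalisable with real diagonal, and each diagonal entry
    descends to an eigenvalue of [A] itself. *)
Lemma symmetric_quadratic (R : rcfType) n (A : 'M[R]_n) (a b : R) :
  A^T = A -> (forall x, eigenvalue A x -> x = a \/ x = b) ->
  (A - a%:M) *m (A - b%:M) = 0.
Proof.
move=> symA eigA; pose toC := real_complex R; pose B := map_mx toC A.
have real_toC x : toC x \is Num.real.
  by apply/Creal_ImP; rewrite /= -complexIm.
have hermB : B \is hermsymmx.
  apply: realsym_hermsym.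
    by apply/is_hermitianmxP; rewrite expr0 scale1r map_mx_id // map_trmx symA.
  by apply/mxOverP => i j; rewrite mxE.
have /hermitian_normalmx/orthomx_spectralP := hermB.
set P := spectralmx B; set d := spectral_diag B => BE.
have Punit : P \in unitmx by apply: spectral_unit.
have dE i : d 0 i = toC a \/ d 0 i = toC b.
  have dreal : d 0 i \is Num.real.
    by have /mxOverP := hermitian_spectral_diag_real hermB; apply.
  have dRe := RRe_real dreal.
  have : eigenvalue A (complex.Re (d 0 i)).
    rewrite -(eigenvalue_map (real_complex R)) -/toC; apply/eigenvalueP.
    exists (row i P); last first.
      apply/eqP => P0; have := mulmxV Punit => /(congr1 (row i)).
      rewrite row_mul P0 mul0mx => /rowP/(_ i); rewrite !mxE eqxx => /eqP.
      by rewrite eq_sym oner_eq0.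
    have PB : P *m B = diag_mx d *m P by rewrite {1}BE !mulmxA mulmxV // mul1mx.
    by rewrite -/B -row_mul PB row_mul row_diag_mx -scalemxAl -rowE -[in LHS]dRe.
  by case/eigA => <-; [left|right]; rewrite /toC dRe.
apply: (map_mx_inj (f := toC)).
rewrite map_mx0 map_mxM !map_mxB !map_scalar_mx -/B.
have shift c : B - c%:M = invmx P *m (diag_mx d - c%:M) *m P.
  by rewrite mulmxBr mulmxBl -BE mul_mx_scalar -scalemxAl mulVmx // scalemx1.
rewrite !shift -!mulmxA (mulmxA P) mulmxV // mul1mx (mulmxA (_ - _) (_ - _)).
suff -> : (diag_mx d - (toC a)%:M) *m (diag_mx d - (toC b)%:M) = 0.
  by rewrite mul0mx mulmx0.
have diagB c : diag_mx d - c%:M = diag_mx (\row_i (d 0 i - c)).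
  by apply/matrixP => i j; rewrite !mxE; case: eqP; rewrite ?subrr ?mulr1n ?mulr0n ?subr0.
rewrite !diagB mulmx_diag; apply/matrixP => i j; rewrite !mxE.
by case: (dE i) => ->; rewrite subrr ?mul0r ?mulr0 mul0rn.
Qed.

(** The eigenspace of [a] lies in the row space of [A - b%:M], and the rank condition makes the two
    equal. *)
Lemma eigenspaces_full_quadratic (F : fieldType) n (A : 'M[F]_n) (a b : F) :
  a != b -> (\rank (eigenspace A a) + \rank (eigenspace A b) = n)%N ->
  (A - b%:M) *m (A - a%:M) = 0.
Proof.
move=> ab; set K := eigenspace A a => rank_ab.
have KA : K *m (A - a%:M) = 0 by exact: mulmx_ker.
have K_sub : (K <= A - b%:M)%MS.
  have KE : K *m (A - b%:M) = (a - b) *: K.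
    rewrite (_ : A - b%:M = A - a%:M + (a - b)%:M); last by rewrite raddfB /= addrA subrK.
    by rewrite mulmxDr KA add0r mul_mx_scalar.
  have -> : K = (a - b)^-1 *: K *m (A - b%:M).
    by rewrite -scalemxAl KE scalerA mulVf ?scale1r // subr_eq0.
  exact: submxMl.
have : (A - b%:M <= K)%MS.
  have := mxrank_leqif_sup K_sub => -[_ <-].
  have := mxrank_ker (A - b%:M); rewrite -/(eigenspace A b).
  have := rank_leq_row (A - b%:M); lia.
by move/submxP=> [D ->]; rewrite -mulmxA KA mulmx0.
Qed.

Lemma quadratic_projection (F : fieldType) n (A : 'M[F]_n) (a b : F) :
  a != b -> A^T = A -> (A - b%:M) *m (A - a%:M) = 0 ->
  let P := (a - b)^-1 *: (A - b%:M) in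
  [/\ P^T = P, P *m P = P,
      (\rank P + \rank (eigenspace A b) = n)%N &
      (\rank (1%:M - P)%R + \rank (eigenspace A a) = n)%N].
Proof.
move=> ab symA quad P; have ab0 : a - b != 0 by rewrite subr_eq0.
have P1 : 1%:M - P = - ((a - b)^-1 *: (A - a%:M)).
  apply: (scalerI ab0); rewrite scalerBr scalerN !scalerA divff // !scale1r.
  by rewrite scalemx1 raddfB /= opprB addrCA opprB addrAC addrCA subrr addr0 addrC.
split.
- by rewrite /P linearZ /= linearB /= symA tr_scalar_mx.
- have : P *m (1%:M - P) = 0.
    by rewrite P1 mulmxN -scalemxAl -scalemxAr quad !scaler0 oppr0.
  by rewrite mulmxBr mulmx1 => /subr0_eq.
- rewrite mxrank_scale_nz ?invr_eq0 // mxrank_ker.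
  by rewrite subnKC // rank_leq_row.
- rewrite P1 mxrank_opp mxrank_scale_nz ?invr_eq0 // mxrank_ker.
  by rewrite subnKC // rank_leq_row.
Qed.

Lemma mxtrace_idempotent (F : fieldType) n (P : 'M[F]_n) :
  P *m P = P -> \tr P = (\rank P)%:R.
Proof.
move=> PP; have BC : row_base P *m col_base P = 1%:M.
  apply: (row_full_inj (col_base_full P)); apply: (row_free_inj (row_base_free P)).
  by rewrite mulmx1 mulmx_base mulmxA mulmx_base -mulmxA mulmx_base.
by rewrite -{1}(mulmx_base P) mxtrace_mulC BC mxtrace1.
Qed.

(** (1 + A) / 2 is the projection onto the eigenspace of 1, and the rank of an idempotent is its
    trace. *)
Lemma involution_multiplicity (R : numFieldType) n (A : 'M[R]_n) (t : nat) :
  A^T = A -> A *m A = 1%:M -> \tr A = t%:R *+ 2 - n%:R -> (t <= n)%N ->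
  \rank (eigenspace A 1) = t /\ \rank (eigenspace A (-1)) = (n - t)%N.
Proof.
move=> symA AA trA tn.
have ne : (1 : R) != -1 by rewrite -subr_eq0 opprK -mulr2n pnatr_eq0.
have quad : (A - (-1)%:M) *m (A - 1%:M) = 0.
  rewrite raddfN opprK mulmxBr mulmxDl mul1mx mulmx1 AA.
  by rewrite [1%:M + A]addrC subrr.
have [symP PP rP rQ] := quadratic_projection ne symA quad.
set P := _ *: _ in symP PP rP rQ.
have rankP : \rank P = t.
  apply/eqP; rewrite -(eqr_nat R) -mxtrace_idempotent // mxtraceZ linearB /=.
  rewrite trA mxtrace_scalar opprK mulNrn opprK subrK -mulr2n.
  by rewrite -[t%:R *+ 2]mulr_natr mulrC mulfK ?pnatr_eq0.
have tr_rank : (\rank P + \rank (1%:M - P)%R = n)%N.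
  have QQ : (1%:M - P) *m (1%:M - P) = 1%:M - P.
    by rewrite mulmxBr mulmx1 mulmxBl mul1mx PP subrr subr0.
  apply/eqP; rewrite -(eqr_nat R) natrD -!mxtrace_idempotent //.
  by rewrite linearB /= mxtrace1 addrC subrK.
split; last by rewrite -[X in (X - _)%N]rP rankP addKn.
by apply: (@addnI (\rank (1%:M - P)%R)); rewrite rQ -[LHS]tr_rank rankP addnC.
Qed.

Lemma join_realization (R : realType) k l (m : 'I_k -> nat) (n : 'I_l -> nat)
    q1 q2 (t : nat) :
  two_level (class_size m n) q1 q2 ->
  (0 < \sum_i (q1 (inl i) + q2 (inl i)))%N ->
  (\sum_i (q1 (inl i) + q2 (inl i)) <= t)%N ->
  (t + \sum_i (q1 (inl i) + q2 (inl i)) <= msum m + msum n)%N ->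
  exists A : 'M[R]_#|graph_join (Kunion m) (Kunion n)|,
    [/\ inS A, eigenvalues A = [set 1; -1]%classic, multiplicity A 1 = t &
        multiplicity A (-1) = (msum m + msum n - t)%N].
Proof.
move=> tl s_gt0 s_le_t ts_le.
have [||| A [symA AA trA patA]] := @realize_two_level R _ _ _
    (vertex_label (m := m) (n := n)) q1 q2 t; rewrite ?card_join //.
  case: tl => h1 h2 h3 h4 h5; split => // a; rewrite card_vertex_label //.
  exact: h2.
have [|m1 m2] := involution_multiplicity symA AA trA; first by rewrite card_join; lia.
exists A; split=> //; first exact/inS_join.
  have ev x : eigenvalue A x = (0 < \rank (eigenspace A x))%N.
    by rewrite lt0n mxrank_eq0.
  have ev1 : eigenvalue A 1 by rewrite ev m1; lia.
  have evN1 : eigenvalue A (-1) by rewrite ev m2 card_join; lia.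
  apply/seteqP; split=> [x|x [->|->]] //=.
  case/eigenvalueP => v vA v0; have : v *m A *m A = v by rewrite -mulmxA AA mulmx1.
  rewrite vA -scalemxAl vA scalerA => /eqP; rewrite -subr_eq0 -{2}[v]scale1r.
  rewrite -scalerBl scaler_eq0 (negPf v0) orbF -expr2 subr_eq0 sqrf_eq1.
  by case/orP => /eqP; [left|right].
by rewrite /multiplicity m2 card_join.
Qed.

Lemma join_rank_bound (R : realType) k l (m : 'I_k -> nat) (n : 'I_l -> nat)
    (A : 'M[R]_#|graph_join (Kunion m) (Kunion n)|) (a b : R) :
  (0 < k)%N -> (0 < l)%N -> (forall i, 0 < m i)%N -> (forall j, 0 < n j)%N ->
  inS A -> a != b -> (A - b%:M) *m (A - a%:M) = 0 ->
  exists r, [/\ (l <= r)%N,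
    (r + maxn (multiplicity A a) (multiplicity A b) <= msum m + msum n)%N,
    (r <= minn (msum m) (msum n))%N &
    (\sum_i (m i - (1 < m i)) < l)%N -> (forall i, 1 < m i)%N /\ (2 * k <= r)%N].
Proof.
move=> k_gt0 l_gt0 m_gt0 n_gt0 /inS_join[symA patA] ab quad.
have [symP PP rP rQ] := quadratic_projection ab symA quad.
set P := _ *: _ in symP PP rP rQ.
have ab0 : (a - b)^-1 != 0 by rewrite invr_eq0 subr_eq0.
have patP : join_pattern (vertex_label (m := m) (n := n)) P.
  move=> u v uv; rewrite -patA // !mxE (negPf uv) mulr0n subr0.
  by rewrite mulf_eq0 (negPf ab0).
have [|r] := join_projection_rank k_gt0 l_gt0 _ symP PP patP.
  by move=> x; rewrite card_vertex_label; case: x.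
have szE x : #|[set u | vertex_label (m := m) (n := n) u == x]| = class_size m n x.
  exact: card_vertex_label.
move=> [lr rmin rsum special]; exists r; split=> //.
- move: rmin; rewrite leq_min -card_join /multiplicity addn_maxr geq_max.
  move=> /andP[r1 r2]; apply/andP; split.
    by rewrite -[X in (_ <= X)%N]rQ leq_add2r.
  by rewrite -[X in (_ <= X)%N]rP leq_add2r.
- move: rsum; congr (_ <= minn _ _)%N; apply: eq_bigr => x _; exact: szE.
- move=> S_lt; have [|m_gt1 ->] := special; last first.
    by split=> // i; have := m_gt1 i; rewrite szE.
  move: S_lt; congr (_ < _)%N; apply: eq_bigr => i _; by rewrite szE.
Qed.

(** * Multiplicity matrices *)

(** With all vertices in one class, a generic conjugate of a diagonal matrix has an off-diagonal
    zero only if the matrix is scalar, and two distinct eigenvalues occur here. *)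
Lemma complete_multiplicity_vector (R : realType) n r (v : 'I_r -> nat) :
  (\sum_s v s = n)%N -> ((1 < n)%N -> forall s, v s != n) ->
  multiplicity_vector R (complete n) v.
Proof.
move=> sum_v v_ne; have e : (\sum_s v s)%N = #|complete n| by rewrite sum_v card_ord.
pose lam (s : 'I_r) : R := (s : nat)%:R.
pose D := castmx (e, e) (Dmx lam v).
have symD : D^T = D.
  rewrite /D trmx_cast; congr (castmx _ _).
  by rewrite /Dmx tr_mxdiag; apply: eq_mxdiag => s; rewrite tr_scalar_mx.
have [O [OO _] OP] := generic_conj (fun=> tt) symD.
exists e, lam, O; split=> //; first by move=> i j ij; rewrite ltr_nat.
split; first exact: conj_sym.
move=> i j ij; rewrite (_ : adj _ _ = true); last first.
  by rewrite /adj /= /complete_adj (inj_eq enum_val_inj).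
apply/negP => /eqP /(OP i j ij)[c scal].
have lamE s : (0 < v s)%N -> lam s = c.
  move=> vs; pose u := tagnat.Rank s (Ordinal vs).
  have := scal (cast_ord e u) (cast_ord e u) erefl erefl.
  rewrite castmxE !cast_ordK eqxx mulr1n => <-.
  have : submxblock (Dmx lam v) s s (Ordinal vs) (Ordinal vs) = lam s.
    by rewrite submxblock_diag mxE eqxx mulr1n.
  by rewrite mxE.
have n_gt1 : (1 < n)%N.
  rewrite -[n](card_ord n) -/(#|complete n|).
  have := ltn_ord i; have := ltn_ord j.
  have : (i : nat) != j by []. lia.
have [s vs] : exists s, (0 < v s)%N.
  have [/existsP//|/existsPn h] := boolP [exists s, (0 < v s)%N].
  by move: sum_v; rewrite big1 => [n0|s _]; [rewrite -n0 in n_gt1 | have := h s; lia].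
have := v_ne n_gt1 s; rewrite -sum_v (bigD1 s) //= -{1}[v s]addn0 eqn_add2l eq_sym.
rewrite sum_nat_eq0 negb_forall => /existsP[s']; rewrite negb_imply => /andP[s's].
rewrite -lt0n => /lamE; rewrite -(lamE s vs) => /eqP; rewrite eqr_nat => /eqP/val_inj E.
by rewrite E eqxx in s's.
Qed.

Lemma multiplicity_vector_complete (R : realType) n r (v : 'I_r -> nat) :
  multiplicity_vector R (complete n) v ->
  (\sum_s v s = n)%N /\ ((1 < n)%N -> forall s, v s != n).
Proof.
move=> [e [lam [U [_ UU [_ pat]]]]].
have sum_v : (\sum_s v s = n)%N by rewrite e card_ord.
split=> // n_gt1 s; apply/eqP => vs.
have v0 s' : s' != s -> v s' = 0%N.
  move=> s's; have : (\sum_(x | x != s) v x = 0)%N.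
    by move: sum_v; rewrite (bigD1 s) //= vs -[RHS]addn0 => /addnI.
  by move/eqP; rewrite sum_nat_eq0 => /forallP/(_ s'); rewrite s's => /eqP.
have DE : Dmx lam v = (lam s)%:M.
  rewrite -mxdiagZ; apply: eq_mxdiag => s'; have [->//|s's] := eqVneq s' s.
  by apply/matrixP => -[x xlt]; exfalso; rewrite v0 in xlt.
have n_gt0 : (0 < #|complete n|)%N by rewrite card_ord ltnW.
have n_gt1' : (1 < #|complete n|)%N by rewrite card_ord.
have := pat (Ordinal n_gt0) (Ordinal n_gt1') isT.
rewrite /adj /= /complete_adj (inj_eq enum_val_inj) /=.
have -> : castmx (e, e) (Dmx lam v) = (lam s)%:M.
  by rewrite DE; apply/matrixP => x y; rewrite castmxE !mxE.
by rewrite mul_mx_scalar -scalemxAl UU scalemx1 mxE mulr0n eqxx.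
Qed.

(** * Compatible pairs: the lower bound and its attainment *)

Lemma compatible_row_sums p k l (V : 'M[nat]_(p.+3, k)) (W : 'M[nat]_(p.+3, l)) s :
  compatible V W -> (\sum_j trim V s j)%N = (\sum_j trim W s j)%N.
Proof.
move=> [/matrixP/(_ s 0) VW _].
have E q (X : 'M[nat]_(p.+1, q)) : (X *m const_mx 1) s (0 : 'I_1) = (\sum_j X s j)%N.
  by rewrite mxE; apply: eq_bigr => j _; rewrite mxE mulr1.
by rewrite -!E.
Qed.

Lemma compatible_common_level p k l (V : 'M[nat]_(p.+3, k))
    (W : 'M[nat]_(p.+3, l)) i j :
  compatible V W -> exists s, (0 < trim V s i)%N /\ (0 < trim W s j)%N.
Proof.
move=> [_ /(_ i j)]; rewrite mxE.
have [/existsP[s /andP[? ?]]|/existsPn h] :=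
  boolP [exists s, (0 < trim V s i)%N && (0 < trim W s j)%N]; first by exists s.
rewrite big1 // => s _; rewrite mxE; have := h s.
by case: (trim V s i) => [|x]; [rewrite mul0r | case: (trim W s j) => [|y]; rewrite ?mulr0].
Qed.

Lemma compatible_sum_bound (R : realType) k l (m : 'I_k -> nat)
    p (V : 'M[nat]_(p.+3, k)) (W : 'M[nat]_(p.+3, l)) :
  (0 < k)%N -> (forall i, 0 < m i)%N ->
  multiplicity_matrix R (Kcomponents m) V -> compatible V W ->
  ((if \sum_i (m i - (1 < m i)) < l < 2 * k then 2 * k else l) <=
    \sum_(i < p.+1) \sum_(j < k) trim V i j)%N.
Proof.
move=> k_gt0 m_gt0 mulV compat.
have l_le : (l <= \sum_(i < p.+1) \sum_(j < k) trim V i j)%N.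
  under eq_bigr do rewrite (compatible_row_sums _ compat).
  rewrite exchange_big -[l in (l <= _)%N]muln1; apply: sum_le_const => j.
  have [s [_ Ws]] := compatible_common_level (Ordinal k_gt0) j compat.
  by rewrite (bigD1 s) //= ltn_addr.
case: ifP => // /andP[S_lt l_lt]; rewrite exchange_big mulnC.
apply: sum_le_const => i /=; rewrite leqNgt; apply/negP => c_lt2.
have [s0 [Vs0 _]] : exists s, (0 < trim V s i)%N /\ True.
  have l_gt0 : (0 < l)%N by apply: leq_ltn_trans S_lt.
  by have [s [? _]] := compatible_common_level i (Ordinal l_gt0) compat; exists s.
have V0 s : s != s0 -> trim V s i = 0%N.
  move=> ss0; move: c_lt2; rewrite (bigD1 s0) //= (bigD1 s) //=; lia.
(* Column i has its only interior entry at [s0], so every right column is positive there. The row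
   sum then reaches l and exceeds the capacity of one row. *)
have : (l <= \sum_j trim V s0 j)%N.
  rewrite (compatible_row_sums _ compat) -[l in (l <= _)%N]muln1.
  apply: sum_le_const => j.
  have [s [Vs Ws]] := compatible_common_level i j compat.
  by have [<-//|/V0 Vs0'] := eqVneq s s0; rewrite Vs0' in Vs.
apply/negP; rewrite -ltnNge; apply: leq_ltn_trans S_lt; apply: leq_sum => j _.
have [sumV neV] := multiplicity_vector_complete (mulV j).
pose s1 := lift ord_max (lift ord0 s0).
have -> : trim V s0 j = V s1 j by rewrite !mxE.
have : (V s1 j <= m j)%N by rewrite -sumV (bigD1 s1) //= leq_addr.
case: ltnP => /= [/neV/(_ s1)|_]; lia.
Qed.

Lemma mu_set_two_level (R : realType) k l (m : 'I_k -> nat) (n : 'I_l -> nat)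
    q1 q2 :
  (0 < k)%N -> (0 < l)%N -> two_level (class_size m n) q1 q2 ->
  exists p (V : 'M[nat]_(p.+3, k)) (W : 'M[nat]_(p.+3, l)),
    [/\ multiplicity_matrix R (Kcomponents m) V,
        multiplicity_matrix R (Kcomponents n) W, compatible V W
      & (\sum_i (q1 (inl i) + q2 (inl i)) =
         \sum_(i < p.+1) \sum_(j < k) trim V i j)%N].
Proof.
move=> k_gt0 l_gt0 [qle qne q1sum q2sum shared].
(* The surplus goes to the first row and the last row is zero; trimming removes both. The first
   entry stays below the order because [q1 a + q2 a > 0]. *)
pose col a (s : 'I_4) :=
  nth 0%N [:: class_size m n a - (q1 a + q2 a); q1 a; q2 a; 0]%N s.
have colP a : multiplicity_vector R (complete (class_size m n a)) (col a).
  have /andP[q_gt0 q_le] := qle a.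
  apply: complete_multiplicity_vector.
    by rewrite !big_ord_recl big_ord0 /col /=; lia.
  move=> /qne /andP[h1 h2] [[|[|[|[|//]]]] lt4]; rewrite /col /=; lia.
pose V := \matrix_(s < 4, i < k) col (inl i) s.
pose W := \matrix_(s < 4, j < l) col (inr j) s.
have VE s i : V s i = col (inl i) s by rewrite mxE.
have WE s j : W s j = col (inr j) s by rewrite mxE.
have trimV s i : trim V s i = if s == 0 then q1 (inl i) else q2 (inl i).
  by rewrite !mxE /col lift_max /=; case: s => [[|[|//]] ?].
have trimW s j : trim W s j = if s == 0 then q1 (inr j) else q2 (inr j).
  by rewrite !mxE /col lift_max /=; case: s => [[|[|//]] ?].
have mxvecE r (G : sgraph) (v w : 'I_r -> nat) : v =1 w ->
    multiplicity_vector R G v -> multiplicity_vector R G w.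
  by move=> /boolp.funext ->.
exists 1%N, V, W; split.
- by move=> i; apply: mxvecE (colP (inl i)) => s; rewrite VE.
- by move=> j; apply: mxvecE (colP (inr j)) => s; rewrite WE.
- split.
    apply/matrixP => s z; rewrite !mxE.
    transitivity (\sum_i trim V s i)%N.
      by apply: eq_bigr => i _; rewrite [X in _ * X]mxE mulr1.
    transitivity (\sum_j trim W s j)%N; last first.
      by apply: eq_bigr => j _; rewrite [X in _ * X]mxE mulr1.
    under eq_bigr do rewrite trimV; under [RHS]eq_bigr do rewrite trimW.
    by case: (s == 0).
  move=> i j; rewrite mxE !big_ord_recl big_ord0 ![_^T _ _]mxE !trimV !trimW /=.
  by have := shared i j; rewrite addn_gt0 addr0.
by rewrite !big_ord_recl big_ord0 addn0 /= big_split; congr (_ + _)%N;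
  apply: eq_bigr => i _; rewrite trimV.
Qed.

(** * The minimum and the range of multiplicities *)

Lemma set_min_eq (A : set nat) v :
  A v -> (forall b, A b -> (v <= b)%N) -> set_min A = v.
Proof.
move=> Av v_min; rewrite /set_min; case: xgetP => [y _ [Ay y_min]|/(_ v) []//].
by apply/eqP; rewrite eqn_leq y_min // v_min.
Qed.

(** The value 0 is also the default for the empty set, so only a nonzero value certifies
    attainment. *)
Lemma set_min_mem (A : set nat) : set_min A != 0%N -> A (set_min A).
Proof. by rewrite /set_min; case: xgetP => [y _ []|]. Qed.

(** Termwise, m_i + [m_i = 1] - 1 = m_i - [m_i > 1]. *)
Lemma nonconcentrated_capacity k (m : 'I_k -> nat) :
  (forall i, 0 < m i)%N ->
  (msum m + num_ones m - k = \sum_i (m i - (1 < m i)))%N.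
Proof.
move=> m_gt0; have -> : num_ones m = (\sum_i (m i == 1))%N.
  by rewrite /num_ones -sum1_card big_mkcond; apply: eq_bigr => i _; rewrite inE; case: eqP.
rewrite /msum -big_split /=.
apply: (@addIn k); rewrite subnK.
  rewrite -[X in (_ + X)%N]muln1 -(sum_eq_const k 1) -big_split /=.
  by apply: eq_bigr => i _; have := m_gt0 i; case: eqP; case: ltnP => /=; lia.
rewrite -[X in (X <= _)%N]muln1; apply: sum_le_const => i.
by rewrite ltn_addr.
Qed.

(* k, l, m_i, n_j range over the positive integers, so the truncated subtraction
   msum m + num_ones m - k is exact. *)
Theorem theorem4p21 (R : realType) (k l : nat)
    (m : 'I_k -> nat) (n : 'I_l -> nat)
    (k_gt0 : (0 < k)%N) (le_kl : (k <= l)%N)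
    (m_gt0 : forall i, (0 < m i)%N) (n_gt0 : forall j, (0 < n j)%N)
    (q2 : qnum R (graph_join (Kunion m) (Kunion n)) = 2%N) :
  mu R m n = (if (msum m + num_ones m - k < l < 2 * k)%N then 2 * k else l)%N
  /\
  forall t : int,
    (exists A : 'M[R]_#|graph_join (Kunion m) (Kunion n)|,
       inS A /\
       exists a b : R,
         [/\ a != b,
             eigenvalues A = [set a; b]%classic,
             (multiplicity A a)%:Z = t
           & (multiplicity A b)%:Z = (msum m + msum n)%:Z - t])
    <-> (mu R m n)%:Z <= t <= (msum m + msum n)%:Z - (mu R m n)%:Z.
Proof.
have l_gt0 : (0 < l)%N by apply: leq_trans le_kl.
have [A0 [SA0 /card_eq2[a0 [b0 [ab0 eigA0]]]]] :
    exists A : 'M[R]_#|graph_join (Kunion m) (Kunion n)|,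
      inS A /\ (eigenvalues A #= `I_2)%card.
  by have := @set_min_mem _ (etrans (congr1 (fun x => x != 0%N) q2) erefl);
    rewrite -/(qnum R _) q2.
rewrite nonconcentrated_capacity //.
set v := (if _ then _ else _)%N.
have quad0 : (A0 - b0%:M) *m (A0 - a0%:M) = 0.
  apply: symmetric_quadratic; first by case: SA0.
  move=> x xA0; have : eigenvalues A0 x by [].
  by rewrite eigA0 => -[->|->]; [right|left].
have [r0 [lr0 _ r0_min special0]] :=
  join_rank_bound k_gt0 l_gt0 m_gt0 n_gt0 SA0 ab0 quad0.
have [q1' [q2' [tl q_sum]]] : exists q1 q2, two_level (class_size m n) q1 q2 /\
    (\sum_i (q1 (inl i) + q2 (inl i)) = v)%N.
  apply: two_level_exists => //; first by case.
    by apply: leq_trans lr0 _; move: r0_min; rewrite leq_min => /andP[].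
  move=> /special0[m_gt1 kr0]; split=> //.
  by apply: leq_trans kr0 _; move: r0_min; rewrite leq_min => /andP[].
have v_gt0 : (0 < v)%N by rewrite /v; case: ifP; rewrite ?muln_gt0.
have muE : mu R m n = v.
  apply: set_min_eq => /=.
    by have := mu_set_two_level R k_gt0 l_gt0 tl; rewrite q_sum.
  move=> _ [p [V [W [mulV _ compat ->]]]].
  exact: compatible_sum_bound k_gt0 m_gt0 mulV compat.
split=> // t; rewrite muE; split=> [[A [SA [a [b [ab _ At Bt]]]]]|].
  have rank_ab : (\rank (eigenspace A a) + \rank (eigenspace A b) =
      #|graph_join (Kunion m) (Kunion n)|)%N.
    rewrite [RHS]card_join; apply/eqP; rewrite -eqz_nat PoszD.
    by rewrite -/(multiplicity A a) -/(multiplicity A b) At Bt addrC subrK.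
  have quad := eigenspaces_full_quadratic ab rank_ab.
  have [r [lr r_max _ special]] :=
    join_rank_bound k_gt0 l_gt0 m_gt0 n_gt0 SA ab quad.
  have vr : (v <= r)%N by rewrite /v; case: ifP => // /andP[/special[]].
  (* Adding [r] to either multiplicity, t or |m| + |n| - t, gives at most |m| + |n|, so v <= r
     yields both bounds on t. *)
  lia.
case: t => [t|t] /andP[h1 h2]; last by move: h1; lia.
have vt : (v <= t)%N by rewrite -lez_nat.
have tv : (t + v <= msum m + msum n)%N by rewrite -lez_nat PoszD -lerBrDr.
have [|||A [SA eigA At Bt]] := @join_realization R k l m n q1' q2' t tl;
  rewrite ?q_sum //.
exists A; split=> //; exists 1, (-1); split=> //.
- by rewrite -subr_eq0 opprK -mulr2n pnatr_eq0.
- by rewrite At.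
- by rewrite Bt; lia.
Qed.
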